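(* Let $K$ be an algebraically closed field of characteristic $p=0$ or $p>7$. Let $X_f: y^2=f(x)$ be a genus-$3$ hyperelliptic curve over $K$, where $f$ is regarded as a binary form of degree $8$ with distinct roots. Suppose that for every covariant $C$ of order $4$ of binary forms of degree $8$, the discriminant of the binary quartic form $C(f)$ is zero. Then $\operatorname{Aut}_K X_f$ contains a subgroup isomorphic to $\mathbf{D}_{12}$, to $\mathbf{C}_2\times\mathbf{D}_8$, or to $\mathbf{C}_{14}$.
   Context: $\mathbf{C}_n=\mathbb{Z}/n\mathbb{Z}$, and $\mathbf{D}_{2n}$ is the dihedral group with $2n$ elements. $X_f$ is the smooth curve with affine equation $y^2=f(x)$; when $f$ as a polynomial has degree $7$, the corresponding binary form of degree $8$ has a root at infinity. $\operatorname{Aut}_K X_f$ is the full automorphism group (including the hyperelliptic involution). Covariants: let $S^n(V)$ be the space of binary forms of degree $n$ in $(x,z)$ over $K$, with $M\in\mathrm{GL}_2(K)$ acting by $(M.f)(x,z)=f(M^{-1}(x,z))$. A covariant of order $r\ge0$ of binary forms of degree $n$ is a homogeneous polynomial function $C:S^n(V)\to S^r(V)$ (of some degree $d$ in the coefficients) for which there is $\omega\in\mathbb{Z}$ with $C(M.f)=(\det M)^{-\omega}\,M.C(f)$ for all $M\in\mathrm{GL}_2(K)$ and all $f\in S^n(V)$. The zero quartic form is regarded as having discriminant zero. *)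

(* Defs.v *)
From HB Require Import structures.
From mathcomp Require Import all_boot all_order all_algebra.
From mathcomp Require Import all_fingroup all_solvable.
From mathcomp Require Import ring.
From mathcomp Require Export mpoly.

Set Implicit Arguments.
Unset Strict Implicit.
Unset Printing Implicit Defensive.

Import GRing.Theory.
Local Open Scope ring_scope.

(* Binary forms of degree n are the n-homogeneous elements of {mpoly K[2]};
   variable 0 is x and variable 1 is z. *)

Section BinaryForms.
Variable K : fieldType.

Definition pt2 (a b : K) : 'I_2 -> K := fun i => if i == 0 then a else b.

Definition feval (f : {mpoly K[2]}) (a b : K) : K := f.@[pt2 a b].

(* The exponent of x^(n-i) z^i. *)
Definition bmon (n : nat) (i : 'I_n.+1) : 'X_{1..2} :=
  [multinom [tuple (n - i)%N; (i : nat)]].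

(* f is the sum over i of (fcoef f i) x^(n-i) z^i. *)
Definition fcoef (n : nat) (f : {mpoly K[2]}) : 'I_n.+1 -> K :=
  fun i => f@_(bmon i).

(* (M.f)(x,z) = f(M^-1 (x,z)), with (x,z) a column vector. *)
Definition form_act (M : 'M[K]_2) (f : {mpoly K[2]}) : {mpoly K[2]} :=
  f \mPo [tuple \sum_(j < 2) invmx M i j *: 'X_j | i < 2].

(* C restricts to a map from forms of degree n to forms of degree r whose
   coefficients are homogeneous polynomials of degree d in those of f. *)
Definition homog_polymap (n r d : nat) (C : {mpoly K[2]} -> {mpoly K[2]}) :=
  exists c : 'I_r.+1 -> {mpoly K[n.+1]},
    (forall i, c i \is d.-homog) /\
    (forall f, f \is n.-homog ->
       C f = \sum_(i < r.+1) (c i).@[@fcoef n f] *: 'X_[bmon i]).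

Definition covariant (n r : nat) (C : {mpoly K[2]} -> {mpoly K[2]}) :=
  (exists d : nat, homog_polymap n r d C) /\
  (exists w : int, forall (M : 'M[K]_2) (f : {mpoly K[2]}),
     M \in unitmx -> f \is n.-homog ->
     C (form_act M f) = (\det M) ^ (- w) *: form_act M (C f)).

(* Discriminant of a x^4 + b x^3 z + c x^2 z^2 + d x z^3 + e z^4. *)
Definition disc4 (a b c d e : K) : K :=
  256%:R * a ^+ 3 * e ^+ 3 - 192%:R * a ^+ 2 * b * d * e ^+ 2
  - 128%:R * a ^+ 2 * c ^+ 2 * e ^+ 2 + 144%:R * a ^+ 2 * c * d ^+ 2 * e
  - 27%:R * a ^+ 2 * d ^+ 4 + 144%:R * a * b ^+ 2 * c * e ^+ 2
  - 6%:R * a * b ^+ 2 * d ^+ 2 * e - 80%:R * a * b * c ^+ 2 * d * e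
  + 18%:R * a * b * c * d ^+ 3 + 16%:R * a * c ^+ 4 * e
  - 4%:R * a * c ^+ 3 * d ^+ 2 - 27%:R * b ^+ 4 * e ^+ 2
  + 18%:R * b ^+ 3 * c * d * e - 4%:R * b ^+ 3 * d ^+ 3
  - 4%:R * b ^+ 2 * c ^+ 3 * e + b ^+ 2 * c ^+ 2 * d ^+ 2.

(* The formula above agrees with the usual product over pairs of roots:
   the arguments are the coefficients of prod_i (s_i x - t_i z). *)
Lemma disc4_prod (s1 t1 s2 t2 s3 t3 s4 t4 : K) :
  disc4 (s1 * s2 * s3 * s4)
        (- (t1 * s2 * s3 * s4 + s1 * t2 * s3 * s4
            + s1 * s2 * t3 * s4 + s1 * s2 * s3 * t4))
        (t1 * t2 * s3 * s4 + t1 * s2 * t3 * s4 + t1 * s2 * s3 * t4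
         + s1 * t2 * t3 * s4 + s1 * t2 * s3 * t4 + s1 * s2 * t3 * t4)
        (- (s1 * t2 * t3 * t4 + t1 * s2 * t3 * t4
            + t1 * t2 * s3 * t4 + t1 * t2 * t3 * s4))
        (t1 * t2 * t3 * t4)
  = ((t1 * s2 - t2 * s1) * (t1 * s3 - t3 * s1) * (t1 * s4 - t4 * s1)
     * (t2 * s3 - t3 * s2) * (t2 * s4 - t4 * s2) * (t3 * s4 - t4 * s3)) ^+ 2.
Proof. rewrite /disc4; ring. Qed.

Definition quartic_disc (q : {mpoly K[2]}) : K :=
  let a i := fcoef q (inord i : 'I_5) in
  disc4 (a 0%N) (a 1%N) (a 2%N) (a 3%N) (a 4%N).

(* A form of degree n with n distinct roots (p i).1 : (p i).2 in P^1(K). *)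
Definition distinct_roots (n : nat) (f : {mpoly K[2]}) :=
  [/\ f \is n.-homog, f != 0 &
      exists p : 'I_n -> K * K,
        [/\ forall i, p i != (0, 0),
            forall i j, i != j -> (p i).1 * (p j).2 != (p j).1 * (p i).2 &
            forall i, feval f (p i).1 (p i).2 = 0]].

End BinaryForms.

(* The smooth projective model of y^2 = f(x), for f a binary form of degree 8:
   the affine curves y^2 = f(x,1) and v^2 = f(1,u) glued along
   u = 1/x, v = y/x^4.  As K is algebraically closed, a variety is described
   by its K-points, and a morphism by the induced map on them. *)

Section Curve.
Variables (K : fieldType) (f : {mpoly K[2]}).

(* inl (x, y) is a point of the first chart;
   inr v is the point (u, v) = (0, v) of the second one. *)
Definition on_curve (P : K * K + K) : bool :=
  match P with
  | inl xy => xy.2 ^+ 2 == feval f xy.1 1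
  | inr v => v ^+ 2 == feval f 1 0
  end.

Definition curve : Type := {P : K * K + K | on_curve P}.

(* Coordinates of P in the first (c = false) or second (c = true) chart. *)
Definition chart (c : bool) (P : curve) : option (K * K) :=
  match c, val P with
  | false, inl xy => Some xy
  | false, inr _ => None
  | true, inl xy => if xy.1 == 0 then None
                    else Some (xy.1^-1, xy.2 / xy.1 ^+ 4)
  | true, inr v => Some (0, v)
  end.

(* Around each point of the curve, phi takes values in a single chart and is
   given there by quotients of polynomials in the coordinates of the source. *)
Definition regular_map (phi : curve -> curve) : Prop :=
  forall P : curve,
  exists (c c' : bool) (p : K * K) (g h den : {mpoly K[2]}),
    [/\ chart c P = Some p,
        feval den p.1 p.2 != 0 &
        forall (Q : curve) (q : K * K),
          chart c Q = Some q -> feval den q.1 q.2 != 0 ->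
          chart c' (phi Q) = Some (feval g q.1 q.2 / feval den q.1 q.2,
                                   feval h q.1 q.2 / feval den q.1 q.2)].

Definition curve_aut (phi : curve -> curve) : Prop :=
  regular_map phi /\
  exists psi : curve -> curve,
    [/\ regular_map psi, cancel phi psi & cancel psi phi].

(* The automorphism group of the curve, under composition, has a subgroup
   isomorphic to G: the image of rho. *)
Definition aut_has_subgroup (gT : finGroupType) (G : {group gT}) : Prop :=
  exists rho : gT -> curve -> curve,
    [/\ forall a, a \in G -> curve_aut (rho a),
        forall a b, a \in G -> b \in G -> rho (a * b)%g =1 rho a \o rho b &
        forall a b, a \in G -> b \in G -> rho a =1 rho b -> a = b].

End Curve.

(* Main.v *)
Require Import Defs.
From Stdlib Require Import Classical.
From HB Require Import structures.
From mathcomp Require Import all_boot all_order all_algebra.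
From mathcomp Require Import all_fingroup all_solvable all_field.
From mathcomp Require Import mpoly ring zify.

Set Implicit Arguments.
Unset Strict Implicit.
Unset Printing Implicit Defensive.

Import GRing.Theory.
Local Open Scope ring_scope.

(** Write f as the product of the brackets [x, u_i] = det (x, u_i), where
    u_1, ..., u_8 are vectors in K^2, and let G be the group of the permutations s
    of the roots for which some matrix M takes each u_i to a multiple of u_(s i);
    this is the automorphism group of the curve modulo the hyperelliptic
    involution.  The proof compares G with the values C(f) of the covariants.

    Sums over the orderings of the roots give covariants.  Let P(u; x) be a sum of
    products of brackets, of degree d in each u_i and of degree 4 in x.  The sum of
    P(u_(s 1), ..., u_(s 8); x) over all s is a covariant of order 4 of the form
    with roots u (covariant_orbit_sum).  The point is that its coefficients are
    polynomials of degree d in those of the form: by Ryser's formula they are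
    combinations of products Phi(u_1) ... Phi(u_8) for forms Phi of degree d, and
    factoring Phi makes such a product a product of d values of the form
    (symfun_resultant, symfun_orbit).

    When G has exponent two, these covariants interpolate: a quartic q with
    q(M x) = (det M)^2 q(x) for all M that realize an element of G is a multiple of
    C(f) for some C (covariant_with_value).  Cross-ratios give a bracket polynomial
    J that vanishes at the orderings of the roots outside G but not at u
    (stabilizer_separation).  In the sum over orderings of J^2 T, where T takes the
    value q at u, only the terms in G survive; they are equal, and their number
    divides 8!, which is invertible in K.

    Such a quartic of nonzero discriminant exists if G has exponent two: in suitable
    coordinates all M are diagonal or antidiagonal, and a sum of two fourth powers
    of independent linear forms will do (involutive_semi_invariant).

    So under the hypothesis G has an element of order greater than 2, hence one of
    order n = 3, 4, 5 or 7, since the order of S_8 is 2^7 3^2 5 7.  It is given by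
    diag (1, r) in suitable coordinates, so the exponents of z in f are congruent
    modulo n.  One of the first two and one of the last two coefficients of f are
    nonzero, because f has no double root (diagonal_normal_form).  This excludes
    n = 5 and leaves x z (a x^6 + b x^3 z^3 + c z^6) for n = 3 and
    a x^8 + b x^4 z^4 + c z^8 for n = 4, which have further symmetries that exchange
    x and z up to scaling.  Pairs (M, e) with f(M x) = e^2 f(x) act on the curve by
    (x, y) |-> (M x, e y), and explicit pairs generate the groups D_12, C_2 x D_8
    and, for n = 7, C_14 (embed_D12, embed_C2xD8, embed_C14). *)

(** * Points, brackets and binary forms *)

Section Points.
Variable K : fieldType.
Implicit Types (a b x y : K * K) (M N : 'M[K]_2).

Definition bracket a b : K := a.1 * b.2 - a.2 * b.1.

Definition mxact M x : K * K :=
  (M 0 0 * x.1 + M 0 1 * x.2, M 1 0 * x.1 + M 1 1 * x.2).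

Definition scale_pt (c : K) x : K * K := (c * x.1, c * x.2).

Lemma sum2 (R : nmodType) (F : 'I_2 -> R) : \sum_i F i = F 0 + F 1.
Proof.
rewrite big_ord_recl big_ord1; congr (F _ + F _); exact: val_inj.
Qed.

Lemma prod2 (R : pzSemiRingType) (F : 'I_2 -> R) : \prod_i F i = F 0 * F 1.
Proof.
rewrite big_ord_recl big_ord1; congr (F _ * F _); exact: val_inj.
Qed.

Lemma det2 M : \det M = M 0 0 * M 1 1 - M 0 1 * M 1 0.
Proof.
rewrite (expand_det_row _ 0) sum2 /cofactor !det_mx11 !mxE /=.
rewrite (_ : lift 0 0 = 1 :> 'I_2); last exact: val_inj.
rewrite (_ : lift 1 0 = 0 :> 'I_2); last exact: val_inj.
by rewrite expr0 expr1; ring.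
Qed.

Lemma mxact_mul M N x : mxact (M *m N) x = mxact M (mxact N x).
Proof. by rewrite /mxact !mxE !sum2 /=; congr (_, _); ring. Qed.

Lemma mxact_scal c x : mxact c%:M x = scale_pt c x.
Proof. by rewrite /mxact !mxE /= /scale_pt; congr (_, _); ring. Qed.

Lemma scale_pt1 x : scale_pt 1 x = x.
Proof. by case: x => a b; rewrite /scale_pt !mul1r. Qed.

Lemma scale_pt_mul c d x : scale_pt c (scale_pt d x) = scale_pt (c * d) x.
Proof. by rewrite /scale_pt /= !mulrA. Qed.

Lemma mxact1 x : mxact 1%:M x = x.
Proof. by rewrite mxact_scal scale_pt1. Qed.

Lemma mxact_scale_pt M c x : mxact M (scale_pt c x) = scale_pt c (mxact M x).
Proof. by rewrite /mxact /scale_pt /=; congr (_, _); ring. Qed.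

Lemma mxactK M : M \in unitmx -> cancel (mxact M) (mxact (invmx M)).
Proof. by move=> uM x; rewrite -mxact_mul mulVmx // mxact1. Qed.

Lemma mxactVK M : M \in unitmx -> cancel (mxact (invmx M)) (mxact M).
Proof. by move=> uM x; rewrite -mxact_mul mulmxV // mxact1. Qed.

Lemma bracket_mxact M a b : bracket (mxact M a) (mxact M b) = \det M * bracket a b.
Proof. by rewrite det2 /bracket /mxact /=; ring. Qed.

Lemma bracket_scale_ptl c a b : bracket (scale_pt c a) b = c * bracket a b.
Proof. by rewrite /bracket /=; ring. Qed.

Lemma bracket_scale_ptr c a b : bracket a (scale_pt c b) = c * bracket a b.
Proof. by rewrite /bracket /=; ring. Qed.

Lemma bracketC a b : bracket b a = - bracket a b.
Proof. by rewrite /bracket; ring. Qed.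

Lemma bracketxx a : bracket a a = 0.
Proof. by rewrite /bracket; ring. Qed.

Lemma bracket_eq0_scale_pt a b : a != (0, 0) -> bracket a b = 0 -> exists c, b = scale_pt c a.
Proof.
case: a b => a1 a2 [b1 b2]; rewrite /bracket /scale_pt xpair_eqE negb_and /=.
move=> nz /eqP; rewrite subr_eq0 => /eqP e.
have [a10|a10] := eqVneq a1 0.
  move: nz e; rewrite a10 eqxx /= mul0r => a20 /esym/eqP.
  rewrite mulf_eq0 (negPf a20) /= => /eqP->.
  by exists (b2 / a2); rewrite mulr0 divfK.
by exists (b1 / a1); rewrite divfK // mulrAC [b1 * _]mulrC -e mulrAC mulfV ?mul1r.
Qed.

Lemma bracket_neq0 a b : bracket a b != 0 -> a != (0, 0).
Proof. by apply: contraNneq => ->; rewrite /bracket /= !mul0r subr0. Qed.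

Lemma unitmx_det M : (M \in unitmx) = (\det M != 0).
Proof. by rewrite unitmxE unitfE. Qed.

Lemma mx2P M N : (M 0 0 = N 0 0) -> (M 0 1 = N 0 1) -> (M 1 0 = N 1 0) ->
  (M 1 1 = N 1 1) -> M = N.
Proof.
move=> e00 e01 e10 e11; apply/matrixP => i j.
case: i => [[|[|//]] Hi]; case: j => [[|[|//]] Hj];
  [move: e00 | move: e01 | move: e10 | move: e11];
  congr (_ = _); congr (_ _ _); exact: val_inj.
Qed.

End Points.

Section HForm.
Variable K : fieldType.
Implicit Types (x : K * K) (F G : {poly K}).

(** Homogenisation of F in degree n, with F recovered at x = 1; each missing degree
    of F counts for a root at the point (0, 1). *)
Definition bform n F x : K :=
  \sum_(i < n.+1) F`_i * (x.1 ^+ (n - i) * x.2 ^+ i).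

Lemma bform0 n x : bform n 0 x = 0.
Proof. by rewrite /bform big1 // => i _; rewrite coef0 mul0r. Qed.

Lemma bformD n F G x : bform n (F + G) x = bform n F x + bform n G x.
Proof. by rewrite /bform -big_split; apply: eq_bigr => i _; rewrite coefD mulrDl. Qed.

Lemma bformZ n c F x : bform n (c *: F) x = c * bform n F x.
Proof. by rewrite /bform big_distrr; apply: eq_bigr => i _; rewrite coefZ -mulrA. Qed.

Lemma bformXn n k x : (k <= n)%N -> bform n 'X^k x = x.1 ^+ (n - k) * x.2 ^+ k.
Proof.
move=> kn; rewrite /bform (bigD1 (Ordinal (n:=n.+1) (m:=k) kn)) //=.
rewrite coefXn eqxx mul1r big1 ?addr0 // => i; rewrite -val_eqE /= => ne.
by rewrite coefXn (negPf ne) mul0r.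
Qed.

Lemma bform_low n F x : F`_n.+1 = 0 -> bform n.+1 F x = x.1 * bform n F x.
Proof.
move=> F0; rewrite /bform big_ord_recr /= F0 mul0r addr0 big_distrr /=.
by apply: eq_bigr => i _; rewrite subSn -1?ltnS // exprS; ring.
Qed.

Lemma bform_mulXsub n G r x : (size G <= n.+1)%N ->
  bform n.+1 (G * ('X - r%:P)) x = (x.2 - r * x.1) * bform n G x.
Proof.
move=> sG.
have -> : bform n.+1 (G * ('X - r%:P)) x = bform n.+1 (G * 'X) x - r * bform n.+1 G x.
  by rewrite mulrBr [G * r%:P]mulrC mul_polyC -[- (r *: G)]scaleN1r bformD !bformZ mulN1r.
rewrite (@bform_low n G) ?nth_default // {1}/bform big_ord_recl coefMX /= mul0r add0r.
rewrite mulrBl mulrA; congr (_ - _); rewrite /bform big_distrr /=.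
by apply: eq_bigr => i _; rewrite coefMX /= subSS exprS; ring.
Qed.

Lemma bform_1t n F t : (size F <= n.+1)%N -> bform n F (1, t) = F.[t].
Proof.
move=> sF; rewrite /bform (horner_coef_wide _ sF).
by apply: eq_bigr => i _; rewrite /= expr1n mul1r.
Qed.

End HForm.

Section ClosedForms.
Variable K : closedFieldType.
Implicit Types (x : K * K) (F G : {poly K}).

Lemma nth_root_closed n (c : K) : (0 < n)%N -> exists r, r ^+ n = c.
Proof.
move=> n0; have /closed_rootP [r] : size ('X^n - c%:P) != 1%N.
  by rewrite size_XnsubC // eqSS -lt0n.
by rewrite rootE !hornerE subr_eq0 => /eqP; exists r.
Qed.

(** A root of F - 1 will do. *)
Lemma poly_nonroot F : F != 0 -> exists t, F.[t] != 0.
Proof.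
move=> F0; have [s1|s1] := leqP (size F) 1.
  by exists 0; rewrite (size1_polyC s1) hornerC -polyC_eq0 -size1_polyC.
have sF1: size (F - 1) = size F by rewrite size_polyDl // size_polyN size_poly1.
have /closed_rootP [t] : size (F - 1) != 1%N by rewrite sF1 neq_ltn s1 orbT.
by rewrite rootE !hornerE subr_eq0 => /eqP Ft; exists t; rewrite Ft oner_neq0.
Qed.

Lemma poly_fun_eq F G : (forall t, F.[t] = G.[t]) -> F = G.
Proof.
move=> e; apply/eqP; rewrite -subr_eq0; apply: contraT => /poly_nonroot[t].
by rewrite !hornerE e subrr eqxx.
Qed.

Lemma bform_inj n F G : bform n F =1 bform n G -> forall i, (i <= n)%N -> F`_i = G`_i.
Proof.
move=> e i le.
have E (H : {poly K}) x : bform n H x = bform n (\poly_(i < n.+1) H`_i) x.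
  by apply: eq_bigr => j _; rewrite coef_poly ltn_ord.
have : \poly_(i < n.+1) F`_i = \poly_(i < n.+1) G`_i.
  apply: poly_fun_eq => t; rewrite -!(@bform_1t _ n) ?size_poly //.
  by rewrite -!E.
by move/(congr1 (fun p : {poly K} => p`_i)); rewrite !coef_poly ltnS le.
Qed.

(** Induction on n: if the top coefficient vanishes, the factor x splits off, and
    otherwise F has a root, whose linear factor splits off. *)
Lemma bform_factor n F : (size F <= n.+1)%N ->
  exists c (u : 'I_n -> K * K), forall x, bform n F x = c * \prod_i bracket x (u i).
Proof.
elim: n F => [|n IHn] F sF.
  exists F`_0, (fun=> 0) => x.
  by rewrite /bform big_ord1 big_ord0 !expr0 !mulr1.
suff [a [G [sG hG]]] : exists a G, (size G <= n.+1)%N /\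
    forall x, bform n.+1 F x = bracket x a * bform n G x.
  have [c [u hu]] := IHn G sG.
  exists c, (fun i => oapp u a (unlift ord_max i)) => x.
  rewrite hG hu big_ord_recr /= unlift_none /= mulrC mulrA; congr (_ * _ * _).
  apply: eq_bigr => i _; congr (bracket _ _).
  by rewrite (_ : widen_ord _ i = lift ord_max i) ?liftK //; apply: val_inj; rewrite /= /bump leqNgt ltn_ord.
have [F0|F0] := eqVneq F`_n.+1 0.
  have sF' : (size F <= n.+1)%N.
    rewrite leqNgt; apply/negP => lt.
    have sE : size F = n.+2 by apply/eqP; rewrite eqn_leq sF.
    have : lead_coef F != 0 by rewrite lead_coef_eq0 -size_poly_eq0 sE.
    by rewrite lead_coefE sE F0 eqxx.
  exists (0, 1), F; split=> // x; rewrite bform_low // /bracket /=; congr (_ * _); ring.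
have /closed_rootP [r] : size F != 1%N.
  by apply: contraNneq F0 => s1; rewrite nth_default // s1.
case/factor_theorem => G eF.
have sG : (size G <= n.+1)%N.
  have [->|G0] := eqVneq G 0; first by rewrite size_poly0.
  by move: sF; rewrite eF size_Mmonic ?monicXsubC // size_XsubC addn2.
exists (-1, -r), G; split=> // x; rewrite eF bform_mulXsub // /bracket /=; congr (_ * _); ring.
Qed.

End ClosedForms.

Section MForms.
Variable K : closedFieldType.
Implicit Types (f g : {mpoly K[2]}) (x : K * K).

Definition fev f x := feval f x.1 x.2.

(** Forms are handled through this univariate polynomial: two forms of degree n are
    equal as soon as they have the same values, since K is infinite. *)
Definition fpoly n f : {poly K} := \poly_(i < n.+1) fcoef f (inord i : 'I_n.+1).

Definition form n (F : {poly K}) : {mpoly K[2]} :=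
  \sum_(i < n.+1) F`_i *: 'X_[bmon i].

Lemma bmon0E n (i : 'I_n.+1) : bmon i 0 = (n - i)%N.
Proof. by []. Qed.

Lemma bmon1E n (i : 'I_n.+1) : bmon i 1 = i.
Proof. by []. Qed.

Lemma mdeg_bmon n (i : 'I_n.+1) : mdeg (bmon i) = n.
Proof. by rewrite mdegE sum2 bmon0E bmon1E; apply: subnK; rewrite -ltnS. Qed.

Lemma bmon_inj n : injective (@bmon n).
Proof.
move=> i j /(congr1 (fun m : 'X_{1..2} => m 1%R)).
by rewrite !bmon1E => e; apply: val_inj.
Qed.

Lemma form_homog n F : form n F \is n.-homog.
Proof.
by apply: rpred_sum => i _; apply: dhomogZ; rewrite dhomogX; apply/eqP; apply: mdeg_bmon.
Qed.

Lemma fcoef_form n F (i : 'I_n.+1) : fcoef (form n F) i = F`_i.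
Proof.
rewrite /fcoef /form raddf_sum (bigD1 i) //= mcoeffZ mcoeffX eqxx mulr1.
rewrite big1 ?addr0 // => j ne; rewrite mcoeffZ mcoeffX.
by rewrite (inj_eq (@bmon_inj n)) (negPf ne) mulr0.
Qed.

Lemma formK n f : f \is n.-homog -> form n (fpoly n f) = f.
Proof.
move=> hf; apply/mpolyP => m.
have [dm|dm] := eqVneq (mdeg m) n; last first.
  by rewrite !(dhomog_nemf_coeff (mf := mdeg) (d := n)) ?form_homog.
have m1 : (m 1%R < n.+1)%N.
  by move: dm; rewrite mdegE sum2 ltnS => <-; apply: leq_addl.
have -> : m = bmon (Ordinal m1).
  have dm0 : m 0%R = (n - m 1%R)%N by rewrite -dm mdegE sum2 addnK.
  apply/mnmP => -[[|[|//]] Hi].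
    by rewrite (_ : Ordinal Hi = 0%R) ?bmon0E //; apply: val_inj.
  by rewrite (_ : Ordinal Hi = 1%R) ?bmon1E //; apply: val_inj.
rewrite -/(fcoef (form n (fpoly n f)) (Ordinal m1)) fcoef_form coef_poly m1.
by rewrite /fcoef; congr (_@_(bmon _)); apply: val_inj; rewrite /= inordK.
Qed.

Lemma fev_form n F x : fev (form n F) x = bform n F x.
Proof.
rewrite /fev /feval /form raddf_sum; apply: eq_bigr => i _ /=.
by rewrite mevalZ mevalX prod2 /pt2 /= bmon0E bmon1E.
Qed.

Lemma fev_bform n f x : f \is n.-homog -> fev f x = bform n (fpoly n f) x.
Proof. by move=> hf; rewrite -{1}(formK hf) fev_form. Qed.

Lemma fev_inj n f g : f \is n.-homog -> g \is n.-homog -> fev f =1 fev g -> f = g.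
Proof.
move=> hf hg e; rewrite -(formK hf) -(formK hg).
have := @bform_inj _ n (fpoly n f) (fpoly n g) _.
move=> /(_ _) H; apply: eq_bigr => i _; rewrite H ?[(i <= n)%N]ltn_ord //.
by move=> x; rewrite -!fev_bform.
by rewrite -ltnS.
Qed.

Lemma fev_nonroot n f : f \is n.-homog -> f != 0 -> exists x, fev f x != 0.
Proof.
move=> hf f0; have F0 : fpoly n f != 0.
  apply: contraNneq f0 => F0; rewrite -(formK hf) F0 /form big1 // => i _.
  by rewrite coef0 scale0r.
have [t Ft] := poly_nonroot F0.
by exists (1, t); rewrite (fev_bform _ hf) bform_1t ?size_poly.
Qed.

Lemma fev_act M f x : fev (form_act M f) x = fev f (mxact (invmx M) x).
Proof.
rewrite /fev /feval /form_act comp_mpoly_meval; apply: meval_eq => i.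
rewrite tnth_mktuple sum2 mevalD !mevalZ !mevalXU /pt2 /mxact /=.
case: i => [[|[|//]] Hi] /=.
  by rewrite (_ : Ordinal Hi = 0%R) //; apply: val_inj.
by rewrite (_ : Ordinal Hi = 1%R) //; apply: val_inj.
Qed.

Lemma form_act_homog n M f : f \is n.-homog -> form_act M f \is n.-homog.
Proof.
move=> hf; rewrite -(formK hf) /form_act /form raddf_sum /=.
apply: rpred_sum => i _; rewrite comp_mpolyZ; apply: dhomogZ.
rewrite comp_mpolyX -[X in X.-homog](mdeg_bmon i) mdegE.
rewrite !big_ord_recl !big_ord0; apply: dhomogM; [|apply: dhomogM; last exact: dhomog1];
 rewrite -[X in X.-homog]mul1n; apply: dhomogMn; rewrite tnth_mktuple;
 by apply: rpred_sum => j _; apply: dhomogZ; rewrite dhomogX; apply/eqP; apply: mdeg1.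
Qed.

Lemma fev_factor n f : (0 < n)%N -> f \is n.-homog ->
  exists u : 'I_n -> K * K, forall x, fev f x = \prod_i bracket x (u i).
Proof.
move=> n0 hf; have [c [u hu]] := bform_factor (size_poly _ _ : size (fpoly n f) <= n.+1)%N.
have [r rc] := nth_root_closed c n0.
exists (fun i => scale_pt r (u i)) => x; rewrite (fev_bform _ hf) hu -rc.
under [RHS]eq_bigr do rewrite bracket_scale_ptr.
by rewrite big_split /= prodr_const card_ord.
Qed.

End MForms.

(** * Covariants as sums over the orderings of the roots *)

(** Ryser's formula for the permanent, by inclusion-exclusion: after expanding the
    products, the signs cancel for every map from columns to rows that misses a
    row, and the maps that remain are the permutations.  Being division-free, it
    polarises symmetric tensors over any commutative ring. *)
Lemma permanent_ryser (R : comPzRingType) n (A : 'I_n -> 'I_n -> R) :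
  \sum_(s : 'S_n) \prod_i A i (s i) =
  \sum_(h : {ffun 'I_n -> bool})
     (\prod_i (if h i then 1 else -1)) * \prod_j \sum_(i | h i) A i j.
Proof.
pose sg b : R := if b then 1 else -1.
(* the total sign attached to g *)
pose N (g : {ffun 'I_n -> 'I_n}) := \sum_(h : {ffun 'I_n -> bool})
  (\prod_i sg (h i)) * \prod_j (h (g j))%:R.
have NE g : N g = (injectiveb g)%:R.
  have E (h : {ffun 'I_n -> bool}) : (\prod_i sg (h i)) * \prod_j (h (g j))%:R =
      \prod_i (sg (h i) * (if i \in codom g then (h i)%:R else 1)) :> R.
    rewrite big_split /=; congr (_ * _).
    have [hg|/forallPn[j hgj]] := boolP [forall j, h (g j)].
      rewrite !big1 // => [i _|j _]; last by rewrite (forallP hg).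
      by case: ifP => // /codomP[j ->]; rewrite (forallP hg).
    rewrite (bigD1 j) //= (negPf hgj) mul0r.
    by rewrite (bigD1 (g j)) //= codom_f (negPf hgj) mul0r.
  rewrite /N (eq_bigr _ (fun h _ => E h)).
  rewrite -(bigA_distr_bigA (fun i b => sg b * (if i \in codom g then b%:R else 1))).
  rewrite (eq_bigr (fun i => (i \in codom g)%:R)); last first.
    by move=> i _; rewrite big_bool /sg /=; case: (i \in codom g);
      rewrite /= ?mulr0 ?mulr1 ?addr0 ?subrr.
  have [/injectiveP gi|gi] := boolP (injectiveb g).
    rewrite big1 // => i _; have [g' gK g'K] := injF_bij gi.
    by rewrite -(g'K i) codom_f.
  have [i iN] : exists i, i \notin codom g.
    apply/existsP; rewrite -negb_forall; apply: contra gi => /forallP si.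
    have /image_injP gi : #|codom g| == #|'I_n|.
      by apply/eqP/eq_card => i; rewrite si.
    by apply/injectiveP => i j; apply: gi.
  by rewrite (bigD1 i) //= (negPf iN) mul0r.
transitivity (\sum_(g : {ffun 'I_n -> 'I_n} | injectiveb g) \prod_j A (g j) j).
  rewrite (reindex_inj invg_inj) /= (reindex (fun s : 'S_n => pval s)) /=; last first.
    by exists (insubd (1%g : 'S_n)) => g gP; rewrite ?valKd ?insubdK.
  apply: eq_big => [s|s _]; first by rewrite (valP s).
  rewrite (reindex_inj (@perm_inj _ s)) /=; apply: eq_bigr => i _.
  by rewrite permK pvalE.
rewrite big_mkcond /=.
transitivity (\sum_(g : {ffun 'I_n -> 'I_n}) \prod_j A (g j) j * N g).
  by apply: eq_bigr => g _; rewrite NE; case: ifP; rewrite ?mulr1 ?mulr0.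
rewrite (eq_bigr _ (fun g _ => big_distrr _ _ _)) /=.
rewrite exchange_big /=; apply: eq_bigr => h _.
transitivity (\prod_i sg (h i) *
   \sum_(g : {ffun 'I_n -> 'I_n}) \prod_j ((h (g j))%:R * A (g j) j)).
  by rewrite big_distrr /=; apply: eq_bigr => g _; rewrite big_split /=; ring.
rewrite -(bigA_distr_bigA (fun j i => (h i)%:R * A i j)).
congr (_ * _); apply: eq_bigr => j _; rewrite [RHS]big_mkcond /=.
by apply: eq_bigr => i _; case: (h i); rewrite ?mul1r ?mul0r.
Qed.

Section Sym.
Variables (K : closedFieldType) (n : nat).
Notation pts := ('I_n -> K * K).

Definition has_roots (F : {poly K}) (u : pts) :=
  (size F <= n.+1)%N /\ forall y, bform n F y = \prod_i bracket y (u i).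

(** Functions of the roots that are polynomials of degree d in the coefficients of
    the form with these roots. *)
Definition symfun d (G : pts -> K) :=
  exists2 p : {mpoly K[n.+1]}, p \is d.-homog &
    forall F u, has_roots F u -> G u = p.@[fun j : 'I_n.+1 => F`_j].

Lemma symfun_lin d c G H : symfun d G -> symfun d H ->
  symfun d (fun u => c * G u + H u).
Proof.
move=> [p hp Gp] [q hq Hq]; exists (c *: p + q).
  by apply: dhomogD => //; apply: dhomogZ.
by move=> F u r; rewrite mevalD mevalZ (Gp _ _ r) (Hq _ _ r).
Qed.

Lemma symfun0 d : symfun d (fun=> 0).
Proof. by exists 0; [exact: dhomog0 | move=> F u _; rewrite meval0]. Qed.

Lemma symfun_ext d G H : (forall u, G u = H u) -> symfun d G -> symfun d H.
Proof. by move=> e [p hp Gp]; exists p => // F u r; rewrite -e (Gp _ _ r). Qed.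

Lemma symfun_sum d (I : Type) (s : seq I) (c : I -> K) (G : I -> pts -> K) :
  (forall i, symfun d (G i)) -> symfun d (fun u => \sum_(i <- s) c i * G i u).
Proof.
move=> hG; elim: s => [|i s IH].
  by apply: symfun_ext (symfun0 d) => u; rewrite big_nil.
by apply: symfun_ext (symfun_lin (c i) (hG i) IH) => u; rewrite big_cons.
Qed.

Lemma dhomog_prod1 m d (p : 'I_d -> {mpoly K[m]}) :
  (forall k, p k \is 1.-homog) -> \prod_k p k \is d.-homog.
Proof.
elim: d p => [|d IH] p hp; first by rewrite big_ord0 dhomog1.
by rewrite big_ord_recl; exact: (dhomogM (hp ord0) (IH _ (fun k => hp (lift ord0 k)))).
Qed.

(** This product is the resultant of Phi and the form F with roots u.  Splitting Phi
    instead of F into linear factors turns it into a product of d values of F, and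
    each value of F is linear in the coefficients of F. *)
Lemma symfun_resultant d (Phi : {poly K}) : (size Phi <= d.+1)%N ->
  symfun d (fun u => \prod_j bform d Phi (u j)).
Proof.
move=> /bform_factor[c [w hw]].
pose L (y : K * K) : {mpoly K[n.+1]} :=
  \sum_(i < n.+1) (y.1 ^+ (n - i) * y.2 ^+ i) *: 'X_i.
exists ((c * (-1) ^+ d) ^+ n *: \prod_k L (w k)).
  apply: dhomogZ; apply: dhomog_prod1 => k; apply: rpred_sum => i _.
  by apply: dhomogZ; rewrite dhomogX; apply/eqP; apply: mdeg1.
move=> F u [_ Fu]; rewrite mevalZ rmorph_prod /=.
transitivity (\prod_j (c * (-1) ^+ d * \prod_k bracket (w k) (u j))).
  apply: eq_bigr => j _; rewrite hw -mulrA; congr (_ * _).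
  rewrite -[X in (-1) ^+ X](card_ord d) -prodr_const -big_split /=.
  by apply: eq_bigr => k _; rewrite mulN1r bracketC.
rewrite big_split /= prodr_const card_ord; congr (_ * _).
rewrite exchange_big /=; apply: eq_bigr => k _; rewrite -Fu /L raddf_sum /=.
by apply: eq_bigr => i _; rewrite mevalZ mevalXU mulrC.
Qed.

(** This is the fundamental theorem on symmetric functions, with control on the
    degree: the sum is a permanent in the values of monomials at the roots, and
    Ryser's formula expresses it by products of values of one form Phi at all the
    roots. *)
Lemma symfun_orbit d (a b : 'I_n -> nat) : (forall i, a i + b i = d)%N ->
  symfun d (fun u => \sum_(s : 'S_n) \prod_i ((u (s i)).1 ^+ a i * (u (s i)).2 ^+ b i)).
Proof.
move=> abd.
pose Phi (h : {ffun 'I_n -> bool}) : {poly K} := \sum_(i | h i) 'X^(b i).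
pose c (h : {ffun 'I_n -> bool}) : K := \prod_i (if h i then 1 else -1).
apply: symfun_ext (symfun_sum (index_enum _) c (fun h => @symfun_resultant d (Phi h) _)).
  move=> u; rewrite (permanent_ryser (fun i j => (u j).1 ^+ a i * (u j).2 ^+ b i)).
  apply: eq_bigr => h _; congr (_ * _); apply: eq_bigr => j _.
  rewrite /Phi (big_morph (fun F => bform d F (u j)) (fun F G => bformD d F G (u j)) (bform0 d (u j))).
  apply: eq_bigr => i _; rewrite bformXn -(abd i) ?leq_addl //.
  by rewrite addnK.
move=> h; apply: (leq_trans (size_sum _ _ _)); apply/bigmax_leqP => i _.
by rewrite size_polyXn ltnS -(abd i) leq_addl.
Qed.

(** Multihomogeneous polynomial functions of n + 1 points, of degree m i in u i and
    of degree e in x. *)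
Inductive multiform (m : 'I_n -> nat) (e : nat) : (pts -> K * K -> K) -> Prop :=
| MMon c (a b : 'I_n -> nat) k l :
    (forall i, a i + b i = m i)%N -> (k + l = e)%N ->
    multiform m e (fun u x => c * (\prod_i ((u i).1 ^+ a i * (u i).2 ^+ b i)
                               * (x.1 ^+ k * x.2 ^+ l)))
| MAdd P Q : multiform m e P -> multiform m e Q -> multiform m e (fun u x => P u x + Q u x)
| MExt P Q : (forall u x, P u x = Q u x) -> multiform m e P -> multiform m e Q.

Lemma multiform_cast m m' e e' P :
  (forall i, m i = m' i) -> e = e' -> multiform m e P -> multiform m' e' P.
Proof.
move=> em <-; elim=> {P}.
- by move=> c a b k l ab kl; apply: MMon => // i; rewrite ab.
- by move=> P Q _ hP _ hQ; apply: MAdd.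
- by move=> P Q PQ _; apply: MExt.
Qed.

Lemma multiform_mul m m' e e' P Q : multiform m e P -> multiform m' e' Q ->
  multiform (fun i => m i + m' i)%N (e + e') (fun u x => P u x * Q u x).
Proof.
move=> hP hQ; elim: hP => {P}.
- move=> c a b k l ab kl; elim: hQ => {Q}.
  + move=> c' a' b' k' l' ab' kl'.
    apply: MExt (@MMon _ _ (c * c') (fun i => a i + a' i)%N (fun i => b i + b' i)%N
                   (k + k')%N (l + l')%N _ _).
    * move=> u x.
      transitivity ((c * c') * (\prod_i (((u i).1 ^+ a i * (u i).2 ^+ b i) *
                  ((u i).1 ^+ a' i * (u i).2 ^+ b' i)) * (x.1 ^+ (k + k') * x.2 ^+ (l + l')))).
        congr (_ * (_ * _)); apply: eq_bigr => i _; rewrite !exprD; ring.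
      by rewrite big_split /= !exprD; ring.
    * by move=> i; rewrite -ab -ab'; lia.
    * by rewrite -kl -kl'; lia.
  + move=> P Q _ hP _ hQ; apply: MExt (MAdd hP hQ) => u x; rewrite mulrDr //.
  + by move=> P Q PQ _; apply: MExt => u x; rewrite PQ.
- by move=> P P' _ hP _ hP'; apply: MExt (MAdd hP hP') => u x; rewrite mulrDl.
- by move=> P P' PP' _; apply: MExt => u x; rewrite PP'.
Qed.

Lemma multiform_const c : multiform (fun=> 0%N) 0 (fun _ _ => c).
Proof.
apply: MExt (@MMon _ _ c (fun=> 0%N) (fun=> 0%N) 0 0 _ _) => // u x.
by rewrite big1 ?mulr1 // => i _; rewrite mulr1.
Qed.

Lemma multiform_scal m e c P : multiform m e P -> multiform m e (fun u x => c * P u x).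
Proof. by move=> hP; apply: multiform_cast (multiform_mul (multiform_const c) hP). Qed.

Lemma multiform_exp m e P k : multiform m e P ->
  multiform (fun i => k * m i)%N (k * e) (fun u x => P u x ^+ k).
Proof.
move=> hP; elim: k => [|k IH]; first exact: multiform_cast (multiform_const 1).
apply: MExt (multiform_cast _ _ (multiform_mul hP IH)) => [u x|i|]; rewrite ?exprS //.
Qed.

Lemma prod_delta (F : 'I_n -> K) j : \prod_i F i ^+ (i == j) = F j.
Proof.
by rewrite (bigD1 j) //= eqxx big1 ?mulr1 // => i /negPf->.
Qed.

Lemma multiform_bracket (j k : 'I_n) :
  multiform (fun i => (i == j) + (i == k))%N 0 (fun u _ => bracket (u j) (u k)).
Proof.
apply: MExt (MAdd (@MMon _ _ 1 (fun i => i == j : nat) (fun i => i == k : nat) 0 0 _ _)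
  (@MMon _ _ (-1) (fun i => i == k : nat) (fun i => i == j : nat) 0 0 _ _)) => //.
  move=> u x; rewrite !big_split /= !(prod_delta (fun i => (u i).1)).
  by rewrite !(prod_delta (fun i => (u i).2)) /bracket; ring.
by move=> i; rewrite addnC.
Qed.

Lemma multiform_bracketx (j : 'I_n) : multiform (fun i => i == j : nat) 1 (fun u x => bracket x (u j)).
Proof.
apply: MExt (MAdd (@MMon _ _ 1 (fun=> 0%N) (fun i => i == j : nat) 1 0 _ _)
  (@MMon _ _ (-1) (fun i => i == j : nat) (fun=> 0%N) 0 1 _ _)) => //.
  move=> u x; rewrite !big_split /= !(prod_delta (fun i => (u i).1)).
  rewrite !(prod_delta (fun i => (u i).2)) /bracket.
  have E (G : 'I_n -> K) : \prod_i G i ^+ 0 = 1 by rewrite big1.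
  by rewrite (E (fun i => (u i).1)); ring.
by move=> i; rewrite addn0.
Qed.

Lemma multiform_eq m e P u u' x : multiform m e P -> u =1 u' -> P u x = P u' x.
Proof.
move=> hP uu'; elim: hP => {P} [c a b k l _ _|P Q _ -> _ ->|P Q PQ _] //.
  by congr (_ * (_ * _)); apply: eq_bigr => i _; rewrite uu'.
by rewrite -!PQ.
Qed.

Lemma multiform_scale_pt m e P (mu : 'I_n -> K) u x : multiform m e P ->
  P (fun i => scale_pt (mu i) (u i)) x = \prod_i mu i ^+ m i * P u x.
Proof.
elim=> {P} [c a b k l ab _|P Q _ -> _ ->|P Q PQ _ IH].
- rewrite [in RHS]mulrCA; congr (_ * _); rewrite [RHS]mulrA; congr (_ * _).
  rewrite -big_split /=; apply: eq_bigr => i _.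
  by rewrite -ab exprD !exprMn; ring.
- by rewrite mulrDr.
- by rewrite -!PQ.
Qed.

Definition orbit_sum (P : pts -> K * K -> K) u x := \sum_(s : 'S_n) P (fun i => u (s i)) x.

Lemma orbit_sum_coef d e P : multiform (fun=> d) e P ->
  exists c : 'I_e.+1 -> {mpoly K[n.+1]},
    (forall i, c i \is d.-homog) /\
    forall F u x, has_roots F u ->
      orbit_sum P u x = \sum_i (c i).@[fun j : 'I_n.+1 => F`_j] * (x.1 ^+ (e - i) * x.2 ^+ i).
Proof.
elim=> {P}.
- move=> c a b k l ab kl; have [p hp Hp] := symfun_orbit ab.
  have le : (l < e.+1)%N by rewrite ltnS -kl leq_addl.
  exists (fun i => if i == Ordinal le then c *: p else 0); split=> [i|F u x r].
    by case: ifP => _; [apply: dhomogZ | apply: dhomog0].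
  rewrite (bigD1 (Ordinal le)) //= eqxx [X in _ + X]big1 ?addr0; last first.
    by move=> i /negPf->; rewrite meval0 mul0r.
  rewrite mevalZ -(Hp _ _ r) -kl addnK /orbit_sum -big_distrr /= -mulrA; congr (_ * _).
  by rewrite big_distrl.
- move=> P Q _ [c [hc Pc]] _ [c' [hc' Qc']]; exists (fun i => c i + c' i).
  split=> [i|F u x r]; first exact: dhomogD.
  transitivity (orbit_sum P u x + orbit_sum Q u x); first exact: big_split.
  rewrite (Pc _ _ _ r) (Qc' _ _ _ r).
  by rewrite -big_split /=; apply: eq_bigr => i _; rewrite mevalD mulrDl.
- move=> P Q PQ _ [c [hc Pc]]; exists c; split=> // F u x r.
  by rewrite -(Pc _ _ _ r); apply: eq_bigr => s _; rewrite PQ.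
Qed.

(** Invariance of weight N, as for a polynomial in which each term is a product of N
    brackets. *)
Definition semi_inv N (P : pts -> K * K -> K) := forall M u x, M \in unitmx ->
  P (fun i => mxact M (u i)) (mxact M x) = \det M ^+ N * P u x.

Lemma semi_inv_mul N N' P Q : semi_inv N P -> semi_inv N' Q ->
  semi_inv (N + N') (fun u x => P u x * Q u x).
Proof. by move=> hP hQ M u x uM; rewrite hP // hQ // exprD; ring. Qed.

Lemma semi_inv_add N P Q : semi_inv N P -> semi_inv N Q ->
  semi_inv N (fun u x => P u x + Q u x).
Proof. by move=> hP hQ M u x uM; rewrite hP // hQ // mulrDr. Qed.

Lemma semi_inv_const c : semi_inv 0 (fun _ _ => c).
Proof. by move=> M u x _; rewrite mul1r. Qed.

Lemma semi_inv_scal N c P : semi_inv N P -> semi_inv N (fun u x => c * P u x).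
Proof. by move=> hP M u x uM; rewrite hP // mulrCA. Qed.

Lemma semi_inv_exp N P k : semi_inv N P -> semi_inv (N * k) (fun u x => P u x ^+ k).
Proof. by move=> hP M u x uM; rewrite hP // exprMn exprM. Qed.

Lemma semi_inv_bracket j k : semi_inv 1 (fun u _ => bracket (u j) (u k)).
Proof. by move=> M u x _; rewrite bracket_mxact. Qed.

Lemma semi_inv_bracketx j : semi_inv 1 (fun u x => bracket x (u j)).
Proof. by move=> M u x _; rewrite bracket_mxact. Qed.

(** By symmetry the sum only depends on the form with roots u, and it is polynomial
    in its coefficients by the fundamental theorem above.  For the equivariance,
    the roots of M.f can be taken to be M u_i / det M; this rescaling contributes
    det M to the power - n d, and the weight of P contributes the rest. *)
Lemma covariant_orbit_sum d e N P : (0 < n)%N ->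
  multiform (fun=> d) e P -> semi_inv N P ->
  exists2 C : {mpoly K[2]} -> {mpoly K[2]}, covariant n e C &
    forall f u, f \is n.-homog -> (forall x, fev f x = \prod_i bracket x (u i)) ->
      C f \is e.-homog /\ forall x, fev (C f) x = orbit_sum P u x.
Proof.
move=> n0 hP iP; have [c [hc Pc]] := orbit_sum_coef hP.
pose C (f : {mpoly K[2]}) : {mpoly K[2]} :=
  \sum_(i < e.+1) (c i).@[@fcoef K n f] *: 'X_[bmon i].
have C_homog f : C f \is e.-homog.
  apply: rpred_sum => i _; apply: dhomogZ; rewrite dhomogX.
  by apply/eqP; apply: mdeg_bmon.
have CE f u : f \is n.-homog -> (forall x, fev f x = \prod_i bracket x (u i)) ->
    forall x, fev (C f) x = orbit_sum P u x.
  move=> hf hu x.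
  have r : has_roots (fpoly n f) u.
    by split; [exact: size_poly | move=> y; rewrite -fev_bform].
  rewrite (Pc _ _ _ r) /fev /feval /C raddf_sum; apply: eq_bigr => i _ /=.
  rewrite mevalZ mevalX prod2 /pt2 /= bmon0E bmon1E; congr (_ * _).
  by apply: meval_eq => j; rewrite coef_poly ltn_ord inord_val.
exists C; last by move=> f u hf hu; split; [exact: C_homog | exact: CE hf hu].
split; first by exists d, c.
exists ((n * d)%:Z - N%:Z) => M f uM hof.
have [u hu] := fev_factor n0 hof.
have dM : \det M != 0 by rewrite -unitmx_det.
have hu' x : fev (form_act M f) x =
    \prod_i bracket x (scale_pt (\det M)^-1 (mxact M (u i))).
  rewrite fev_act hu; apply: eq_bigr => i _.
  by rewrite bracket_scale_ptr -{2}(mxactVK uM x) bracket_mxact mulrA mulVf // mul1r.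
apply: (@fev_inj _ e).
- exact: C_homog.
- by apply: dhomogZ; apply: form_act_homog; apply: C_homog.
move=> x; rewrite (CE _ _ (form_act_homog _ hof) hu').
rewrite /fev /feval mevalZ -/(feval _ _ _) -/(fev _ x) fev_act (CE _ _ hof hu).
rewrite /orbit_sum big_distrr /=; apply: eq_bigr => s _.
rewrite (multiform_scale_pt (fun=> (\det M)^-1) (fun i => mxact M (u (s i))) x hP).
rewrite -{1}(mxactVK uM x) iP // mulrA; congr (_ * _).
rewrite prodr_const card_ord -exprM opprB expfzDr // mulrC; congr (_ * _).
by rewrite mulnC exprVn exprnN.
Qed.

End Sym.

(** * Interpolation at the roots *)

Section LinAlg.
Variable K : fieldType.
Implicit Types (a b c x : K * K).

Definition mk2 (p q r s : K) : 'M[K]_2 :=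
  \matrix_(i, j) if i == 0 then (if j == 0 then p else q) else (if j == 0 then r else s).

Lemma mxact_mk2 p q r s x :
  mxact (mk2 p q r s) x = (p * x.1 + q * x.2, r * x.1 + s * x.2).
Proof. by rewrite /mxact !mxE. Qed.

Lemma det_mk2 p q r s : \det (mk2 p q r s) = p * s - q * r.
Proof. by rewrite det2 !mxE. Qed.

(** The quadratic form [N x, x] vanishes at the three points, so it is zero by
    Lagrange interpolation, and this forces N to be scalar. *)
Lemma scalar_of_fix3 (N : 'M[K]_2) a b c :
  bracket a b != 0 -> bracket b c != 0 -> bracket c a != 0 ->
  bracket (mxact N a) a = 0 -> bracket (mxact N b) b = 0 -> bracket (mxact N c) c = 0 ->
  exists v, N = v%:M.
Proof.
move=> ab bc ca Na Nb Nc.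
(* Lagrange interpolation at a, b, c, with denominators cleared *)
have Q0 x : bracket (mxact N x) x = 0.
  apply: (mulIf (mulf_neq0 (mulf_neq0 ab bc) ca)); rewrite mul0r.
  transitivity (- (bracket (mxact N a) a * (bracket x b * bracket x c * bracket b c)
                   + bracket (mxact N b) b * (bracket x a * bracket x c * bracket c a)
                   + bracket (mxact N c) c * (bracket x a * bracket x b * bracket a b))).
    by rewrite /bracket /mxact /=; ring.
  by rewrite Na Nb Nc; ring.
have := Q0 (1, 0); have := Q0 (0, 1); have := Q0 (1, 1).
rewrite /bracket /mxact /= !(mulr1, mulr0, addr0, add0r, subr0, sub0r).
move=> e1 e2 /eqP; rewrite oppr_eq0 => /eqP e3.
exists (N 0 0); apply: mx2P; rewrite !mxE //=.
by move: e1; rewrite e2 e3 addr0 add0r => /eqP; rewrite subr_eq0 => /eqP->.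
Qed.

End LinAlg.

Notation ord8 k := (@Ordinal 8 k isT).

Section Interpolation.
Variable K : closedFieldType.
Implicit Types (u w : 'I_8 -> K * K) (M : 'M[K]_2).

Definition pairwise_indep u := forall i j, i != j -> bracket (u i) (u j) != 0.

(** M induces a projectivity of the line that takes each point u i to w i. *)
Definition moves u w M := M \in unitmx /\ forall i, bracket (mxact M (u i)) (w i) = 0.

(** Used to complete a bracket polynomial in the points 0, 1, 2, i into one that has
    degree one in each of the eight points. *)
Lemma complement_pairs (i : 'I_8) : (2 < i)%N ->
  exists a b c d : 'I_8, forall k : 'I_8,
   ((k == ord8 0) + (k == ord8 1) + (k == ord8 2) + (k == i)
    + (k == a) + (k == b) + (k == c) + (k == d))%N = 1%N.
Proof.
case: i => [[|[|[|[|[|[|[|[|//]]]]]]]] Hi] //= _.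
- by exists (ord8 4), (ord8 5), (ord8 6), (ord8 7); case=> [[|[|[|[|[|[|[|[|//]]]]]]]] Hk].
- by exists (ord8 3), (ord8 5), (ord8 6), (ord8 7); case=> [[|[|[|[|[|[|[|[|//]]]]]]]] Hk].
- by exists (ord8 3), (ord8 4), (ord8 6), (ord8 7); case=> [[|[|[|[|[|[|[|[|//]]]]]]]] Hk].
- by exists (ord8 3), (ord8 4), (ord8 5), (ord8 7); case=> [[|[|[|[|[|[|[|[|//]]]]]]]] Hk].
- by exists (ord8 3), (ord8 4), (ord8 5), (ord8 6); case=> [[|[|[|[|[|[|[|[|//]]]]]]]] Hk].
Qed.

Lemma semi_inv_bracket2 (p q r s : 'I_8) :
  @semi_inv K 8 2 (fun v _ => bracket (v p) (v q) * bracket (v r) (v s)).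
Proof. exact: (@semi_inv_mul K 8 1 1 _ _ (@semi_inv_bracket K 8 p q) (@semi_inv_bracket K 8 r s)). Qed.

(** The function Jf i compares the cross-ratio of the points 0, 1, 2, i with that of
    the same points of w.  If all cross-ratios agree, then the projectivity that
    takes the first three points of w to those of u takes all of w to u. *)
Lemma separation u w : pairwise_indep u -> pairwise_indep w ->
  (exists M, moves w u M) \/
  exists J, [/\ multiform (fun=> 1%N) 0 J, semi_inv 4 J,
                forall x, J w x = 0 & forall x, J u x != 0].
Proof.
move=> iu iw; pose i0 := ord8 0; pose i1 := ord8 1; pose i2 := ord8 2.
pose al := bracket (w i2) (w i0) * bracket (u i1) (u i2).
pose be := - (bracket (w i2) (w i1) * bracket (u i0) (u i2)).
pose Jf i (v : 'I_8 -> K * K) (x : K * K) :=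
  bracket (w i) (w i1) * bracket (w i2) (w i0) * (bracket (v i1) (v i2) * bracket (v i0) (v i))
  + - (bracket (w i) (w i0) * bracket (w i2) (w i1)) * (bracket (v i0) (v i2) * bracket (v i1) (v i)).
have [/forallP J0|/forallPn [i Ji]] := boolP [forall i, Jf i u (0, 0) == 0].
  left.
  (* y |-> al [y, w1] u0 + be [y, w0] u1 takes w0, w1 to multiples of u0, u1;
       al and be make it take w2 to a multiple of u2 *)
  exists (mk2 (al * (u i0).1 * (w i1).2 + be * (u i1).1 * (w i0).2)
              (- (al * (u i0).1 * (w i1).1 + be * (u i1).1 * (w i0).1))
              (al * (u i0).2 * (w i1).2 + be * (u i1).2 * (w i0).2)
              (- (al * (u i0).2 * (w i1).1 + be * (u i1).2 * (w i0).1))).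
  split.
    rewrite unitmx_det det_mk2.
    rewrite [X in X != 0](_ : _ = al * be * (bracket (u i0) (u i1) * bracket (w i1) (w i0))).
      by rewrite /al /be !(mulf_neq0, oppr_eq0) // ?iu ?iw.
    by rewrite /bracket; ring.
  move=> i; move/eqP: (J0 i); rewrite /Jf mxact_mk2 => <-.
  by rewrite /al /be /bracket /=; ring.
right.
have i_gt2 : (2 < i)%N.
  rewrite ltnNge; apply/negP => le; case/negP: Ji; apply/eqP.
  have [->|->|->] : [\/ i = i0, i = i1 | i = i2].
  - by case: i le => [[|[|[|//]]] Hi] _;
      [constructor 1 | constructor 2 | constructor 3]; apply: val_inj.
  - by rewrite /Jf !bracketxx; ring.
  - by rewrite /Jf !bracketxx; ring.
  - by rewrite /Jf /bracket; ring.
have [a [b [c [d abcd]]]] := complement_pairs i_gt2.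
exists (fun v x => Jf i v x * (bracket (v a) (v b) * bracket (v c) (v d))); split.
- apply: multiform_cast (multiform_mul (MAdd _ _) (multiform_mul (multiform_bracket _ a b) (multiform_bracket _ c d)));
    last first.
  + apply: multiform_scal; apply: multiform_cast (multiform_mul (multiform_bracket _ i0 i2) (multiform_bracket _ i1 i)).
      by move=> k; apply: erefl.
    by [].
  + apply: multiform_scal; apply: multiform_cast (multiform_mul (multiform_bracket _ i1 i2) (multiform_bracket _ i0 i)).
      by move=> k; rewrite /= addnACA [X in (X + _)%N = _]addnC; lia.
    by [].
  + by [].
  + by move=> k; rewrite -[RHS](abcd k) /i0 /i1 /i2; lia.
- apply: (@semi_inv_mul _ _ 2 2); last exact: semi_inv_bracket2.
  by apply: semi_inv_add; apply: semi_inv_scal; exact: semi_inv_bracket2.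
- by move=> x; rewrite /Jf /bracket; ring.
- move=> x; apply: mulf_neq0; first exact: Ji.
  have neq (p q : 'I_8) : (forall k : 'I_8, (k == p) + (k == q) <= 1)%N -> p != q.
    by move=> H; apply/eqP => e; move: (H p); rewrite e eqxx.
  by apply: mulf_neq0; apply: iu; apply: neq => k; move: (abcd k); lia.
Qed.

(** The value at x is taken in a frame that moves with the points v 0, v 1, v 2 and
    is the standard one when v = u: the bracket of x with p becomes Y p v x.  The
    other brackets bring the degree in each of the eight points to four. *)
Lemma interpolation_target u (p p' : K * K) A B : pairwise_indep u ->
  exists T, [/\ multiform (fun=> 4%N) 4 T, semi_inv 18 T &
    exists2 c, c != 0 & forall x, T u x = c * (A * bracket x p ^+ 4 + B * bracket x p' ^+ 4)].
Proof.
move=> iu; pose i0 := ord8 0; pose i1 := ord8 1; pose i2 := ord8 2.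
pose Y p0 (v : 'I_8 -> K * K) x :=
  bracket (u i0) p0 / bracket (u i0) (u i2) * (bracket x (v i1) * bracket (v i0) (v i2))
  + - (bracket (u i1) p0 / bracket (u i1) (u i2)) * (bracket x (v i0) * bracket (v i1) (v i2)).
have mY p0 : multiform (fun k => (k == i0) + (k == i1) + (k == i2))%N 1 (Y p0).
  apply: MAdd; apply: multiform_scal;
    apply: multiform_cast (multiform_mul (multiform_bracketx _ _) (multiform_bracket _ _ _)) => // k; lia.
have iY p0 : semi_inv 2 (Y p0).
  by apply: semi_inv_add; apply: semi_inv_scal; exact: (@semi_inv_mul K 8 1 1 _ _ (@semi_inv_bracketx K 8 _) (@semi_inv_bracket K 8 _ _)).
(* Cramer's rule: [u0, u1] x = [x, u1] u0 - [x, u0] u1 *)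
have YE p0 x : Y p0 u x = bracket (u i0) (u i1) * bracket x p0.
  have n02 : bracket (u i0) (u i2) != 0 by apply: iu.
  have n12 : bracket (u i1) (u i2) != 0 by apply: iu.
  by rewrite /Y /=; move: n02 n12; rewrite /bracket => n02 n12; field; rewrite n02 n12.
pose T (v : 'I_8 -> K * K) x :=
  (A * Y p v x ^+ 4 + B * Y p' v x ^+ 4) *
  ((bracket (v (ord8 3)) (v (ord8 4)) * bracket (v (ord8 4)) (v (ord8 5)) * bracket (v (ord8 3)) (v (ord8 5))) ^+ 2
   * bracket (v (ord8 6)) (v (ord8 7)) ^+ 4).
exists T; split.
- apply: multiform_cast (multiform_mul (MAdd (multiform_scal A (multiform_exp 4 (mY p)))
     (multiform_scal B (multiform_exp 4 (mY p'))))
     (multiform_mul (multiform_exp 2 (multiform_mul (multiform_mul (multiform_bracket _ _ _) (multiform_bracket _ _ _))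
                                        (multiform_bracket _ _ _)))
                (multiform_exp 4 (multiform_bracket _ _ _)))) => //.
  by case=> [[|[|[|[|[|[|[|[|//]]]]]]]] Hk].
- apply: (@semi_inv_mul _ _ 8 10).
    by apply: semi_inv_add; apply: semi_inv_scal; exact: (@semi_inv_exp K 8 2 _ 4 (iY _)).
  apply: (@semi_inv_mul _ _ 6 4); last exact: (@semi_inv_exp K 8 1 _ 4 (@semi_inv_bracket K 8 _ _)).
  apply: (@semi_inv_exp _ _ 3); apply: (@semi_inv_mul _ _ 2 1); last exact: semi_inv_bracket.
  exact: semi_inv_bracket2.
exists (bracket (u i0) (u i1) ^+ 4 *
   ((bracket (u (ord8 3)) (u (ord8 4)) * bracket (u (ord8 4)) (u (ord8 5)) * bracket (u (ord8 3)) (u (ord8 5))) ^+ 2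
   * bracket (u (ord8 6)) (u (ord8 7)) ^+ 4)).
  by rewrite !(mulf_neq0, expf_neq0) // iu.
by move=> x; rewrite /T !YE; ring.
Qed.

Lemma multiform_order0 (m : 'I_8 -> nat) P u x y : multiform m 0 P -> P u x = P u y.
Proof.
elim=> {P} [c a b [|//] [|//] _ _|P Q _ -> _ ->|P Q PQ _] //.
by rewrite -!PQ.
Qed.

(** The permutations s realized by some M form the reduced automorphism group of the
    form with roots u. *)
Definition realizes u M (s : 'S_8) := moves u (fun i => u (s i)) M.

Lemma pairwise_indep_perm u (s : 'S_8) : pairwise_indep u -> pairwise_indep (fun i => u (s i)).
Proof. by move=> iu i j ij; apply: iu; rewrite (inj_eq perm_inj). Qed.

Lemma moves_inv u w M : moves u w M -> moves w u (invmx M).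
Proof.
move=> [uM H]; split=> [|i]; first by rewrite unitmx_inv.
apply: (mulfI (_ : \det M != 0)); first by rewrite -unitmx_det.
by rewrite -bracket_mxact mxactVK // mulr0 bracketC H oppr0.
Qed.

(** Multiply the separating functions for all permutations that are not realized. *)
Lemma stabilizer_separation u : pairwise_indep u ->
  exists J k, [/\ multiform (fun=> k) 0 J, semi_inv (4 * k) J, forall x, J u x != 0 &
    forall s : 'S_8, (exists M, realizes u M s) \/ forall x, J (fun i => u (s i)) x = 0].
Proof.
move=> iu.
have [J [k [mJ iJ J1 J0]]] : exists J k, [/\ multiform (fun=> k) 0 J, semi_inv (4 * k) J,
    forall x, J u x != 0 & forall s : 'S_8, s \in enum {: 'S_8} ->
      (exists M, realizes u M s) \/ forall x, J (fun i => u (s i)) x = 0].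
  elim: (enum _) => [|s l [J [k [mJ iJ J1 J0]]]].
    exists (fun _ _ => 1), 0%N; split=> //; [exact: multiform_const | exact: semi_inv_const | ].
    by move=> x; apply: oner_neq0.
  have [[M /moves_inv hM]|[J' [mJ' iJ' J0' J1']]] := separation iu (pairwise_indep_perm s iu).
    exists J, k; split=> // t; rewrite inE => /orP[/eqP->|tl]; last exact: J0.
    by left; exists (invmx M).
  exists (fun v x => J' v x * J v x), k.+1; split.
  - exact: multiform_cast (multiform_mul mJ' mJ).
  - by rewrite mulnS; apply: semi_inv_mul.
  - by move=> x; apply: mulf_neq0.
  - move=> t; rewrite inE => /orP[/eqP->|/J0 [tl|tl]]; first by right=> x; rewrite J0' mul0r.
      by left.
    by right=> x; rewrite tl mulr0.
by exists J, k; split=> // s; apply: J0; rewrite mem_enum.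
Qed.

Lemma moves_scale u w M : pairwise_indep u -> pairwise_indep w -> moves u w M ->
  exists2 mu : 'I_8 -> K, forall i, mu i != 0 &
    forall i, w i = scale_pt (mu i) (mxact M (u i)).
Proof.
move=> iu iw [uM H].
have nz v : pairwise_indep v -> forall i, v i != (0, 0) :> K * K.
  move=> iv i; have [j ij] : exists j : 'I_8, i != j.
    by have [->|] := eqVneq i (ord8 0); [exists (ord8 1) | exists (ord8 0)].
  exact: bracket_neq0 (iv _ _ ij).
have /fin_all_exists [mu Hmu] : forall i, exists c, w i = scale_pt c (mxact M (u i)).
  move=> i; apply: bracket_eq0_scale_pt => //; apply: contraNneq (nz _ iu i) => e.
  by rewrite -[u i](mxactK uM) e /mxact /= !mulr0 addr0.
exists mu => // i; apply: contraNneq (nz _ iw i) => mu0.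
by rewrite Hmu mu0 /scale_pt !mul0r.
Qed.

Lemma fix8_scalar u N : pairwise_indep u -> (forall i, bracket (mxact N (u i)) (u i) = 0) ->
  exists v, N = v%:M.
Proof.
by move=> iu H; apply: (@scalar_of_fix3 _ _ (u (ord8 0)) (u (ord8 1)) (u (ord8 2))) => //;
  apply: iu.
Qed.

Lemma realizes1 u : realizes u 1%:M 1%g.
Proof. by split=> [|i]; rewrite ?unitmx1 // perm1 mxact1 bracketxx. Qed.

Lemma realizesM u M N s t : pairwise_indep u ->
  realizes u M s -> realizes u N t -> realizes u (N *m M) (s * t)%g.
Proof.
move=> iu hM [uN hN]; have [mu mu0 Hmu] := moves_scale iu (pairwise_indep_perm s iu) hM.
split=> [|i]; first by rewrite unitmx_mul uN hM.1.
rewrite mxact_mul permM; have := hN (s i); rewrite Hmu mxact_scale_pt bracket_scale_ptl => /eqP.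
by rewrite mulf_eq0 (negPf (mu0 i)) => /eqP.
Qed.

End Interpolation.

Section GoodCharacteristic.
Variable K : closedFieldType.
Hypothesis charK : forall p : nat, p \in [pchar K] -> (7 < p)%N.

(** The prime factors of 8! are at most 7. *)
Lemma natf_dvd_fact8 n : (n %| 8`!)%N -> n%:R != 0 :> K.
Proof.
move=> n8; apply/negP => /eqP n0.
have n_gt0 : (0 < n)%N by rewrite (dvdn_gt0 _ n8) ?fact_gt0.
have /(natf0_pchar n_gt0) [p pK] : n%:R == 0 :> K by rewrite n0.
have p_gt7 := charK pK; have pp := pcharf_prime pK.
have : (p %| 8`!)%N by apply: dvdn_trans n8; rewrite (dvdn_pcharf pK) n0.
rewrite 8!factS !Euclid_dvdM //.
have big m : (0 < m)%N -> (m < 8)%N -> (p %| m)%N = false.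
  by move=> m0 m8; apply/negP => /(dvdn_leq m0); lia.
case/orP => [/(dvdn_leq (isT : 0 < 8)%N) p8|]; last by rewrite !big.
by have e : p = 8%N by [lia]; rewrite e in pp.
Qed.

Variables (u : 'I_8 -> K * K) (f : {mpoly K[2]}).
Hypotheses (iu : pairwise_indep u) (hf : f \is 8.-homog)
  (fu : forall x, fev f x = \prod_i bracket x (u i)).

(** Applying M twice multiplies u i by the inverse of mu (s i) * mu i, so M^2 is a
    scalar v with v * mu (s i) * mu i = 1; multiply these eight equations. *)
Lemma involution_multiplier M s (mu : 'I_8 -> K) : realizes u M s -> (s * s = 1)%g ->
  (forall i, u (s i) = scale_pt (mu i) (mxact M (u i))) ->
  ((\prod_i mu i) * \det M ^+ 4) ^+ 2 = 1.
Proof.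
move=> hM ss Hmu; have ssE i : s (s i) = i by rewrite -permM ss perm1.
have Hu i : u i = scale_pt (mu (s i) * mu i) (mxact (M *m M) (u i)).
  by rewrite -{1}(ssE i) Hmu Hmu mxact_scale_pt scale_pt_mul mxact_mul.
have [v vE] : exists v, M *m M = v%:M.
  by apply: (fix8_scalar iu) => i; rewrite {2}Hu bracket_scale_ptr bracketxx mulr0.
have e i : mu (s i) * mu i * v = 1.
  have := Hu i; rewrite vE mxact_scal scale_pt_mul; set c := _ * v => ui.
  have [j ij] : exists j : 'I_8, i != j.
    by have [->|] := eqVneq i (ord8 0); [exists (ord8 1) | exists (ord8 0)].
  apply: (mulIf (iu ij)); rewrite mul1r -bracket_scale_ptl -ui //.
have : \prod_(i < 8) (mu (s i) * mu i * v) = 1 by rewrite big1.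
have pmu : \prod_i mu (s i) = \prod_i mu i by rewrite [RHS](reindex_inj (@perm_inj _ s)).
rewrite !big_split /= pmu prodr_const card_ord => prod1.
have : \det M ^+ 2 = v ^+ 2 by rewrite expr2 -det_mulmx vE det_scalar.
move=> d; have d8 : (\det M ^+ 4) ^+ 2 = v ^+ 8.
  by rewrite exprAC d -exprM.
by rewrite exprMn d8 expr2.
Qed.

(** Sum J^2 T over the orderings of the roots, where J vanishes at the orderings that
    are not realized and T takes the value q at u.  Each realized ordering gives
    J(u)^2 q up to a multiplier, which is an even power of a sign because J is
    squared.  So the sum is J(u)^2 q times the order of a subgroup of S_8, and
    this order is invertible. *)
Lemma covariant_with_value A B p p' :
  let q x := A * bracket x p ^+ 4 + B * bracket x p' ^+ 4 in
  (forall M s, realizes u M s -> (s * s = 1)%g) ->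
  (forall M s, realizes u M s -> forall x, q (mxact M x) = \det M ^+ 2 * q x) ->
  exists2 C, covariant 8 4 C &
    C f \is 4.-homog /\ exists2 c, c != 0 & forall x, fev (C f) x = c * q x.
Proof.
move=> q invol hq.
have [T [mT iT [c c0 Tq]]] := interpolation_target p p' A B iu.
have [J [k [mJ iJ J1 J0]]] := stabilizer_separation iu.
pose P v x := J v x ^+ 2 * T v x.
have mP : multiform (fun=> 2 * k + 4)%N 4 P by apply: multiform_cast (multiform_mul (multiform_exp 2 mJ) mT).
have iP : semi_inv (4 * k * 2 + 18) P by exact: (@semi_inv_mul K 8 (4 * k * 2) 18 _ T (@semi_inv_exp K 8 (4 * k) J 2 iJ) iT).
pose G := [set s : 'S_8 | J (fun i => u (s i)) (0, 0) != 0].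
have GP s : reflect (exists M, realizes u M s) (s \in G).
  rewrite inE; apply: (iffP idP) => [js|[M hM]].
    by have [//|z] := J0 s; rewrite z eqxx in js.
  have [mu mu0 Hmu] := moves_scale iu (pairwise_indep_perm s iu) hM.
  rewrite (multiform_eq _ mJ Hmu) (multiform_scale_pt _ _ _ mJ) -(mxactVK hM.1 (0, 0)) iJ ?hM.1 //.
  rewrite !mulf_neq0 ?expf_neq0 -?unitmx_det ?hM.1 //.
  by apply/prodf_neq0 => i _; rewrite expf_neq0.
have PE s x : s \in G -> P (fun i => u (s i)) x = P u x.
  case/GP=> M hM; have [mu mu0 Hmu] := moves_scale iu (pairwise_indep_perm s iu) hM.
  rewrite (multiform_eq _ mP Hmu) (multiform_scale_pt _ _ _ mP).
  rewrite -{1}(mxactVK hM.1 x) iP ?hM.1 // {1 2}/P !Tq -!/(q _).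
  have := hq _ _ hM (mxact (invmx M) x); rewrite mxactVK ?hM.1 // => ->.
  have e := involution_multiplier hM (invol _ _ hM) Hmu.
  have -> : J u (mxact (invmx M) x) = J u x.
    exact: multiform_order0 mJ.
  rewrite prodrXl.
  transitivity ((((\prod_i mu i) * \det M ^+ 4) ^+ 2) ^+ (k + 2) *
    (J u x ^+ 2 * (c * (\det M ^+ 2 * q (mxact (invmx M) x))))).
    (* the multiplier is the power k + 2 of the square in involution_multiplier *)
    have -> : (2 * k + 4 = 2 * (k + 2))%N by lia.
    have -> : (4 * k * 2 + 18 = 4 * 2 * (k + 2) + 2)%N by lia.
    rewrite exprD !exprM !exprMn.
    by move: (_ ^+ (k + 2)) => a; move: (_ ^+ (k + 2)) => b; ring.
  by rewrite e expr1n mul1r.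
have gG : group_set G.
  apply/group_setP; split=> [|s t /GP[M hM] /GP[N hN]].
    by apply/GP; exists 1%:M; apply: realizes1.
  by apply/GP; exists (N *m M); apply: realizesM.
have [C covC CE] := @covariant_orbit_sum K 8 _ _ _ P isT mP iP.
exists C => //; have [hC Cv] := CE f u hf fu; split=> //.
exists (#|G|%:R * (J u (0, 0) ^+ 2 * c)).
  rewrite !mulf_neq0 ?expf_neq0 //; apply: natf_dvd_fact8.
  have := cardSg (subsetT (Group gG)); rewrite cardsT /= card_Sn //.
move=> x; rewrite Cv /orbit_sum (bigID (mem G)) /= [X in _ + X]big1 ?addr0; last first.
  move=> s; rewrite inE negbK => /eqP; rewrite /P.
  by rewrite (multiform_order0 _ _ (0, 0) mJ) => ->; rewrite expr0n mul0r.
rewrite (eq_bigr _ (fun s sG => PE s x sG)) sumr_const -[LHS]mulr_natl /P Tq.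
by rewrite (multiform_order0 _ _ (0, 0) mJ) -!mulrA.
Qed.

End GoodCharacteristic.

(** * Quartics invariant under a group of exponent two *)

Section Diag.
Variable K : closedFieldType.
Implicit Types (M N P : 'M[K]_2).

(** The polynomial 'X^n - 1 kills M and is separable. *)
Lemma unity_diagonalization M n : M ^+ n = 1 -> n%:R != 0 :> K ->
  exists P a d, P \in unitmx /\ P *m M = mk2 a 0 0 d *m P.
Proof.
move=> Mn n0.
have [rs /esym Ers] := closed_field_poly_normal ('X^n - 1 : {poly K}).
have n_gt0 : (0 < n)%N by case: n n0 {Mn Ers} => //; rewrite eqxx.
move: Ers; rewrite (monicP (monic_Xn_sub_1 K n_gt0)) scale1r => Ers.
have urs : uniq rs by rewrite -separable_prod_XsubC Ers separable_Xn_sub_1.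
have : diagonalizable M.
  apply/diagonalizableP; exists rs => //; rewrite Ers; apply: mxminpoly_min.
  by rewrite rmorphB rmorph1 rmorphXn /= horner_mx_X Mn subrr.
case=> P uP /(diagonalizable_forLR uP) [D MD].
exists P, (D 0 0), (D 0 1); split=> //.
rewrite MD mxpoly.conjVmx // !mulmxA mulmxV // mul1mx; congr (_ *m P).
by apply: mx2P; rewrite !mxE.
Qed.

(** In the projective group, Z is of exponent two, hence commutative.  If some M in Z
    is not scalar, it is diag (a, - a) in suitable coordinates y, and every N in Z
    becomes diagonal or antidiagonal.  A quartic A y_1^4 + B y_2^4 is then
    semi-invariant under the diagonal matrices in Z; one antidiagonal matrix fixes
    the ratio of A and B, and the others agree with it because their products with
    the first one are diagonal with equal squares. *)
Lemma involutive_semi_invariant (Z : 'M[K]_2 -> Prop) : 2%:R != 0 :> K ->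
  (forall M, Z M -> M \in unitmx) ->
  (forall M N, Z M -> Z N -> Z (M *m N)) ->
  (forall M, Z M -> exists v, M *m M = v%:M) ->
  exists A B (p p' : K * K), [/\ A != 0, B != 0, bracket p p' != 0 &
    forall M, Z M -> forall x,
      A * bracket (mxact M x) p ^+ 4 + B * bracket (mxact M x) p' ^+ 4
      = \det M ^+ 2 * (A * bracket x p ^+ 4 + B * bracket x p' ^+ 4)].
Proof.
move=> two_neq0 ZU ZM Z2.
have [[M [ZMM Mns]]|all_scalar] := classic (exists M, Z M /\ ~ exists v, M = v%:M); last first.
  exists 1, 1, (1, 0), (0, 1); split; rewrite ?oner_neq0 //.
    by rewrite /bracket /= !mulr1 !mul0r subr0 oner_neq0.
  move=> M hM x; have [v ->] : exists v, M = v%:M.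
    by apply: NNPP => nv; apply: all_scalar; exists M.
  by rewrite mxact_scal det_scalar /bracket /scale_pt /=; ring.
have [v vE] := Z2 _ ZMM.
have v0 : v != 0.
  have := ZU _ ZMM; rewrite unitmx_det => d0.
  have : \det M ^+ 2 = v ^+ 2 by rewrite expr2 -det_mulmx vE det_scalar.
  by move=> e; apply: contraNneq d0 => v0; move/eqP: e; rewrite v0 expr0n expf_eq0.
have [r rE] := nth_root_closed v (isT : 0 < 2)%N.
have r0 : r != 0 by apply: contraNneq v0 => r0; rewrite -rE r0 expr0n.
have [P [a [d [uP PM]]]] : exists P a d, P \in unitmx /\ P *m M = mk2 a 0 0 d *m P.
  have e : (r^-1 *: M) ^+ 2 = 1.
    by rewrite expr2 -scalerAl -scalerAr scalerA [M * M]vE -scalemx1 scalerA -rE -invfM -expr2 mulVf ?expf_neq0 // scale1r.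
  have [P [a [d [uP PM]]]] := unity_diagonalization e two_neq0.
  exists P, (r * a), (r * d); split=> //.
  move: PM; rewrite -scalemxAr => /(congr1 (fun X => r *: X)).
  rewrite scalerA mulfV // scale1r => ->; rewrite scalemxAl; congr (_ *m _).
  by apply: mx2P; rewrite !mxE /= ?mulr0.
have [cj cjD] : exists cj : 'M[K]_2 -> 'M[K]_2, forall N, cj N = P *m N *m invmx P.
  by exists (fun N => P *m N *m invmx P).
have cjM N N' : cj (N *m N') = cj N *m cj N' by rewrite !cjD !mulmxA mulmxKV.
have cjE : cj M = mk2 a 0 0 d by rewrite cjD PM mulmxK.
have cjP N x : mxact P (mxact N x) = mxact (cj N) (mxact P x).
  by rewrite -!mxact_mul cjD mulmxKV.
have cjs N : Z N -> exists v, cj N *m cj N = v%:M.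
  move=> /Z2 [w wE]; exists w; rewrite -cjM wE cjD mul_mx_scalar -scalemxAl mulmxV //.
  by rewrite scalemx1.
have cjd N : \det (cj N) = \det N.
  by rewrite cjD !det_mulmx det_inv mulrAC mulfV ?mul1r // -unitmx_det.
have sq N w : N *m N = w%:M ->
  [/\ N 0 1 * (N 0 0 + N 1 1) = 0, N 1 0 * (N 0 0 + N 1 1) = 0 & N 0 0 ^+ 2 = N 1 1 ^+ 2].
  move=> e; have E i j := congr1 (fun X : 'M[K]_2 => X i j) e.
  move: (E 0 0) (E 0 1) (E 1 0) (E 1 1); rewrite !mxE !sum2 /= => e00 e01 e10 e11.
  split; [move: e01; rewrite mulr0n => <-; ring | move: e10; rewrite mulr0n => <-; ring |].
  apply/eqP; rewrite -subr_eq0; apply/eqP.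
  by transitivity (N 0 0 * N 0 0 + N 0 1 * N 1 0 - (N 1 0 * N 0 1 + N 1 1 * N 1 1));
    [ring | rewrite e00 e11 subrr].
have ad : a != d.
  apply: contra_notN Mns => /eqP ad; exists a.
  have : cj M = a%:M by rewrite cjE -ad; apply: mx2P; rewrite !mxE.
  move/(congr1 (fun X => invmx P *m X *m P)).
  by rewrite cjD !mulmxA mulVmx // mul1mx mulmxKV // mul_mx_scalar -scalemxAl mulVmx // scalemx1.
have a0d0 : a * d != 0.
  have := ZU _ ZMM; rewrite unitmx_det -cjd cjE det_mk2; congr (_ != _); ring.
have da : d = - a.
  have [w wE] := cjs _ ZMM; have [_ _] := sq _ _ wE.
  rewrite cjE !mxE /= => /eqP; rewrite eqf_sqr (negPf ad) /= => /eqP->.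
  by rewrite opprK.
have a0 : a != 0 by apply: contraNneq a0d0 => ->; rewrite mul0r.
have shape N : Z N ->
    (cj N 0 1 = 0 /\ cj N 1 0 = 0 /\ cj N 0 0 ^+ 2 = cj N 1 1 ^+ 2) \/
    (cj N 0 0 = 0 /\ cj N 1 1 = 0).
  move=> hN; have [w wE] := cjs _ hN; have [s1 s2 s3] := sq _ _ wE.
  have [w' wE'] := cjs _ (ZM _ _ ZMM hN); have [t1 t2 _] := sq _ _ wE'.
  move: t1 t2; rewrite cjM cjE !mxE !sum2 !mxE /= da => t1 t2.
  have {}t1 : cj N 0 1 * (cj N 0 0 - cj N 1 1) = 0.
    apply: (mulfI (_ : a ^+ 2 != 0)); first by rewrite expf_neq0.
    by rewrite mulr0 -t1; ring.
  have {}t2 : cj N 1 0 * (cj N 0 0 - cj N 1 1) = 0.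
    apply: (mulfI (_ : - a ^+ 2 != 0)); first by rewrite oppr_eq0 expf_neq0.
    by rewrite mulr0 -t2; ring.
  have [sum0|sum0] := eqVneq (cj N 0 0 + cj N 1 1) 0; last first.
    left; split; last split=> //.
      by move/eqP: s1; rewrite mulf_eq0 (negPf sum0) orbF => /eqP.
    by move/eqP: s2; rewrite mulf_eq0 (negPf sum0) orbF => /eqP.
  have [dif0|dif0] := eqVneq (cj N 0 0 - cj N 1 1) 0; last first.
    left; split; last split=> //.
      by move/eqP: t1; rewrite mulf_eq0 (negPf dif0) orbF => /eqP.
    by move/eqP: t2; rewrite mulf_eq0 (negPf dif0) orbF => /eqP.
  right; split; apply: (mulfI two_neq0); rewrite mulr0.
    by transitivity (cj N 0 0 + cj N 1 1 + (cj N 0 0 - cj N 1 1)); [ring | rewrite sum0 dif0 addr0].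
  by transitivity (cj N 0 0 + cj N 1 1 - (cj N 0 0 - cj N 1 1)); [ring | rewrite sum0 dif0 subr0].
pose p := (- P 0 1, P 0 0); pose p' := (- P 1 1, P 1 0).
have brp x : bracket x p = (mxact P x).1 by rewrite /bracket /mxact /=; ring.
have brp' x : bracket x p' = (mxact P x).2 by rewrite /bracket /mxact /=; ring.
have pp' : bracket p p' != 0.
  have := uP; rewrite unitmx_det det2 /bracket /= => h; apply: contraNneq h => h.
  by apply/eqP; rewrite -[RHS]h; ring.
have [[N0 [ZN0 [z00 z11]]]|noanti] :=
  classic (exists N, Z N /\ (cj N 0 0 = 0 /\ cj N 1 1 = 0)).
  have dN0 : cj N0 0 1 != 0 /\ cj N0 1 0 != 0.
    have := ZU _ ZN0; rewrite unitmx_det -cjd det2 z00 mul0r sub0r oppr_eq0 mulf_eq0 negb_or.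
    by case/andP.
  exists (cj N0 1 0 ^+ 2), (cj N0 0 1 ^+ 2), p, p'; split; rewrite ?expf_neq0 //.
  - by case: dN0.
  - by case: dN0.
  move=> N ZN x; rewrite -cjd !brp !brp' !cjP; move: (mxact P x) => y.
  rewrite det2 /mxact /=; have [[e01 [e10 e]]|[e00 e11]] := shape _ ZN.
    rewrite e01 e10; transitivity (cj N0 1 0 ^+ 2 * (cj N 0 0 ^+ 2) ^+ 2 * y.1 ^+ 4 +
       cj N0 0 1 ^+ 2 * (cj N 1 1 ^+ 2) ^+ 2 * y.2 ^+ 4); first by ring.
    rewrite e; transitivity (cj N 1 1 ^+ 2 * cj N 1 1 ^+ 2 * (cj N0 1 0 ^+ 2 * y.1 ^+ 4 + cj N0 0 1 ^+ 2 * y.2 ^+ 4)).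
      by ring.
    by rewrite -{1}e; ring.
  have [w wE] := cjs _ (ZM _ _ ZN ZN0); have [_ _] := sq _ _ wE.
  rewrite cjM !mxE !sum2 e00 e11 z00 z11 !mul0r !addr0 !add0r !exprMn => q.
  transitivity (cj N 0 1 ^+ 2 * (cj N 0 1 ^+ 2 * cj N0 1 0 ^+ 2) * y.2 ^+ 4 +
                cj N 1 0 ^+ 2 * (cj N 1 0 ^+ 2 * cj N0 0 1 ^+ 2) * y.1 ^+ 4); first by ring.
  by rewrite q -{2}q; ring.
exists 1, 1, p, p'; split; rewrite ?oner_neq0 // => N ZN x.
rewrite -cjd !brp !brp' !cjP; move: (mxact P x) => y.
rewrite det2 /mxact /=; have [[e01 [e10 e]]|anti] := shape _ ZN; last first.
  by case: noanti; exists N.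
rewrite e01 e10; transitivity ((cj N 0 0 ^+ 2) ^+ 2 * y.1 ^+ 4 +
   (cj N 1 1 ^+ 2) ^+ 2 * y.2 ^+ 4); first by ring.
rewrite e; transitivity (cj N 1 1 ^+ 2 * cj N 1 1 ^+ 2 * (y.1 ^+ 4 + y.2 ^+ 4)); first by ring.
by rewrite -{1}e; ring.
Qed.

End Diag.

Section Disc.
Variable K : closedFieldType.

Lemma disc4_two_powers (A B s t s' t' : K) :
  disc4 (A * s ^+ 4 + B * s' ^+ 4)
        (4%:R * (A * s ^+ 3 * t + B * s' ^+ 3 * t'))
        (6%:R * (A * s ^+ 2 * t ^+ 2 + B * s' ^+ 2 * t' ^+ 2))
        (4%:R * (A * s * t ^+ 3 + B * s' * t' ^+ 3))
        (A * t ^+ 4 + B * t' ^+ 4)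
  = 256%:R * A ^+ 3 * B ^+ 3 * (s * t' - t * s') ^+ 12.
Proof. by rewrite /disc4; ring. Qed.

Lemma quartic_disc_two_powers (g : {mpoly K[2]}) A B (p p' : K * K) :
  g \is 4.-homog -> (forall x, fev g x = A * bracket x p ^+ 4 + B * bracket x p' ^+ 4) ->
  quartic_disc g = 256%:R * A ^+ 3 * B ^+ 3 * bracket p p' ^+ 12.
Proof.
move=> hg gE.
pose F : {poly K} := Poly [:: A * p.2 ^+ 4 + B * p'.2 ^+ 4;
        4%:R * (A * p.2 ^+ 3 * - p.1 + B * p'.2 ^+ 3 * - p'.1);
        6%:R * (A * p.2 ^+ 2 * (- p.1) ^+ 2 + B * p'.2 ^+ 2 * (- p'.1) ^+ 2);
        4%:R * (A * p.2 * (- p.1) ^+ 3 + B * p'.2 * (- p'.1) ^+ 3);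
        A * (- p.1) ^+ 4 + B * (- p'.1) ^+ 4].
have gF i : (i <= 4)%N -> fcoef g (inord i : 'I_5) = F`_i.
  move=> i4; have := @bform_inj _ 4 (fpoly 4 g) F _ i i4; rewrite coef_poly ltnS i4; apply.
  move=> x; rewrite -fev_bform // gE /bform !big_ord_recl big_ord0 /F !coef_Poly /= /bracket; ring.
rewrite /quartic_disc !gF // /F !coef_Poly /= disc4_two_powers /bracket.
congr (_ * _); ring.
Qed.

End Disc.

(** * Coefficients of a form with a diagonal symmetry *)

Section Support.
Variable K : closedFieldType.
Implicit Types (F : {poly K}) (v : 'I_8 -> K * K).

(** Otherwise the square of the second coordinate divides the form, and (1, 0) is a double root. *)
Lemma simple_root_low F v : has_roots F v -> pairwise_indep v ->
  F`_0 != 0 \/ F`_1 != 0.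
Proof.
move=> [sF Fv] iv.
have FE : F = \prod_i ((v i).2%:P - (v i).1 *: 'X).
  apply: poly_fun_eq => t; rewrite -(bform_1t t sF) Fv horner_prod.
  by apply: eq_bigr => i _; rewrite !hornerE /bracket /= mul1r mulrC.
have [F0|] := eqVneq F`_0 0; [right | by left].
have : \prod_i (v i).2 == 0.
  rewrite -F0 FE -horner_coef0 horner_prod; apply/eqP; apply: eq_bigr => i _.
  by rewrite !hornerE ?mulr0 ?subr0.
case/prodf_eq0 => i _ /eqP vi2.
have vj j : j != i -> (v i).1 * (v j).2 != 0.
  by rewrite eq_sym => /iv; rewrite /bracket vi2 mul0r subr0.
rewrite FE (bigD1 i) //= vi2 sub0r mulNr -scalerAl -mulrC -scaleNr coefZ coefMX /=.
rewrite -horner_coef0 horner_prod mulf_neq0 // ?oppr_eq0.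
  have [j ij] : exists j : 'I_8, j != i.
    by have [->|ne] := eqVneq i (ord8 0); [exists (ord8 1) | exists (ord8 0); rewrite eq_sym].
  by apply: contraNneq (vj j ij) => ->; rewrite mul0r.
apply/prodf_neq0 => j /vj; rewrite !hornerE ?mulr0 ?subr0.
by apply: contraNneq => ->; rewrite mulr0.
Qed.

(** Exchange the two coordinates. *)
Lemma simple_root_high F v : has_roots F v -> pairwise_indep v ->
  F`_8 != 0 \/ F`_7 != 0.
Proof.
move=> [sF Fv] iv.
pose G : {poly K} := \poly_(i < 9) F`_(8 - i).
have := @simple_root_low G (fun i => ((v i).2, (v i).1)).
rewrite !coef_poly /=; apply; last first.
  by move=> i j /iv; rewrite bracketC oppr_eq0; apply: contraNneq => <-; rewrite /bracket /= mulrC [X in _ - X]mulrC.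
split; first exact: size_poly.
move=> y; transitivity (bform 8 F (y.2, y.1)).
  rewrite /bform (reindex_inj rev_ord_inj) /=; apply: eq_bigr => i _.
  have le : (i <= 8)%N by rewrite -ltnS.
  rewrite coef_poly subSS ltnS leq_subr (subKn le); congr (_ * _).
  by rewrite mulrC.
rewrite Fv.
transitivity (\prod_(i < 8) (- 1 * bracket y ((v i).2, (v i).1))).
  by apply: eq_bigr => i _; rewrite /bracket /=; ring.
by rewrite big_split /= prodr_const card_ord !exprS expr0; ring.
Qed.

Lemma eigen_support F a d l : a != 0 ->
  (forall y, bform 8 F (a * y.1, d * y.2) = l * bform 8 F y) ->
  forall i j, (i <= 8)%N -> (j <= 8)%N -> F`_i != 0 -> F`_j != 0 -> (d / a) ^+ i = (d / a) ^+ j.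
Proof.
move=> a0 H.
suff E i : (i <= 8)%N -> F`_i != 0 -> a ^+ 8 * (d / a) ^+ i = l.
  move=> i j i8 j8 /(E _ i8) e /(E _ j8) e'; apply: (mulfI (expf_neq0 8 a0)).
  by rewrite e e'.
move=> i8 Fi.
have := @bform_inj _ 8 (\poly_(i < 9) (F`_i * (a ^+ (8 - i) * d ^+ i))) (l *: F) _ i i8.
rewrite coef_poly coefZ ltnS i8 => /(_ _) e.
apply: (mulfI Fi); rewrite [RHS]mulrC -e.
  congr (_ * _); rewrite expr_div_n -{1}(subnK i8) exprD -mulrA; congr (_ * _).
  by rewrite mulrC divfK // expf_neq0.
move=> y; rewrite bformZ -H; apply: eq_bigr => k _.
by rewrite coef_poly ltn_ord /= !exprMn; ring.
Qed.

End Support.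

(** * Symmetries acting on the curve *)

Section Weighted.
Variable K : closedFieldType.
Implicit Types (x : K * K) (g h : 'M[K]_2 * K).

(** A pair (M, e) stands for the map (x, y) |-> (M x, e y), where x has weight 1 and
    y has weight 4; the pairs (c, c^4) act trivially on the weighted projective
    plane. *)
Definition wscalar (c : K) : 'M[K]_2 * K := (c%:M, c ^+ 4).

Definition wequiv g h := exists2 c, c != 0 & g = wscalar c * h.

Lemma wscalarM c d : wscalar c * wscalar d = wscalar (c * d).
Proof. by congr (_, _); rewrite ?exprMn // [LHS]mul_scalar_mx scale_scalar_mx. Qed.

Lemma wscalar_comm c g : g * wscalar c = wscalar c * g.
Proof.
case: g => M e; congr (_, _); last exact: mulrC.
by rewrite [LHS]mul_mx_scalar [RHS]mul_scalar_mx.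
Qed.

Lemma wscalar1 : wscalar 1 = 1.
Proof. by congr (_, _); rewrite ?expr1n. Qed.

Lemma wequiv_refl g : wequiv g g.
Proof. by exists 1; rewrite ?oner_neq0 // wscalar1 mul1r. Qed.

Lemma wequiv_trans g h k : wequiv g h -> wequiv h k -> wequiv g k.
Proof.
by move=> [c c0 ->] [d d0 ->]; exists (c * d); rewrite ?mulf_neq0 // mulrA wscalarM.
Qed.

Lemma wequiv_sym g h : wequiv g h -> wequiv h g.
Proof.
by move=> [c c0 ->]; exists c^-1; rewrite ?invr_eq0 // mulrA wscalarM mulVf // wscalar1 mul1r.
Qed.

Lemma wequivM g g' h h' : wequiv g g' -> wequiv h h' -> wequiv (g * h) (g' * h').
Proof.
move=> [c c0 ->] [d d0 ->]; exists (c * d); rewrite ?mulf_neq0 //.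
by rewrite -wscalarM !mulrA -(mulrA (wscalar c) g') wscalar_comm !mulrA.
Qed.

Lemma wequivX g h n : wequiv g h -> wequiv (g ^+ n) (h ^+ n).
Proof.
move=> gh; elim: n => [|n IH]; first exact: wequiv_refl.
by rewrite !exprS; apply: wequivM.
Qed.

Lemma wequivX_mod g q m n : wequiv (g ^+ q) 1 -> m = n %[mod q] ->
  wequiv (g ^+ m) (g ^+ n).
Proof.
move=> gq mn.
have E k : wequiv (g ^+ k) (g ^+ (k %% q)).
  rewrite {1}(divn_eq k q) exprD mulnC exprM -[X in wequiv _ X]mul1r.
  apply: wequivM; last exact: wequiv_refl.
  by rewrite -[X in wequiv _ X](expr1n _ (k %/ q)); apply: wequivX.
by apply: wequiv_trans (E m) _; rewrite mn; apply: wequiv_sym.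
Qed.

(** Points of the curve are classes of pairs (x, y) with x nonzero, up to
    (c x, c^4 y); this is the representative with second coordinate of x equal to
    1 or, at infinity, with x = (1, 0). *)
Definition normalize (t : K * K * K) : K * K + K :=
  let: (x, y) := t in
  if x.2 != 0 then inl (x.1 / x.2, y / x.2 ^+ 4) else inr (y / x.1 ^+ 4).

Definition lift_pt (P : K * K + K) : K * K * K :=
  match P with inl xy => ((xy.1, 1), xy.2) | inr v => ((1, 0), v) end.

Lemma lift_ptK P : normalize (lift_pt P) = P.
Proof.
by case: P => [[x y]|v] /=; rewrite ?oner_neq0 ?eqxx /= expr1n !divr1.
Qed.

Lemma normalize_scale_pt c x y : c != 0 ->
  normalize (scale_pt c x, c ^+ 4 * y) = normalize (x, y).
Proof.
move=> c0; rewrite /normalize /scale_pt /= mulf_eq0 (negPf c0) /=.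
by case: ifP => _; rewrite !exprMn -!mulf_div !divff ?mul1r ?expf_neq0 //.
Qed.

Lemma lift_normalize x y : x != (0, 0) ->
  exists2 c, c != 0 & lift_pt (normalize (x, y)) = (scale_pt c x, c ^+ 4 * y).
Proof.
case: x => a b; rewrite xpair_eqE negb_and /normalize /=.
have [->|b0] := eqVneq b 0; rewrite /= ?orbF => a0.
  exists a^-1; rewrite ?invr_eq0 // /scale_pt /= mulVf // mulr0 exprVn mulrC //.
by exists b^-1; rewrite ?invr_eq0 // /scale_pt /= mulVf // exprVn [b^-1 * a]mulrC [_ * y]mulrC.
Qed.

Lemma normalize_inj x : x != (0, 0) -> injective (fun y => normalize (x, y)).
Proof.
case: x => a b; rewrite xpair_eqE negb_and => ab y y'; rewrite /normalize /=.
have [b0|b0] := eqVneq b 0; rewrite /= => -[]; apply: mulIf; rewrite invr_eq0 expf_neq0 //.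
by move: ab; rewrite b0 eqxx orbF.
Qed.

Lemma lift_pt_neq0 P : (lift_pt P).1 != (0, 0).
Proof. by case: P => [[x y]|v] /=; rewrite xpair_eqE oner_eq0 ?andbF. Qed.

Lemma scale_pt_neq0 c x : c != 0 -> x != (0, 0) -> scale_pt c x != (0, 0).
Proof.
by case: x => a b c0; rewrite !xpair_eqE /= !mulf_eq0 (negPf c0).
Qed.

Lemma mxact_neq0 (M : 'M[K]_2) x : M \in unitmx -> x != (0, 0) -> mxact M x != (0, 0).
Proof.
move=> uM; apply: contraNneq => e; rewrite -(mxactK uM x) e.
by rewrite /mxact /= !mulr0 addr0.
Qed.

End Weighted.

Arguments mxact : simpl never.
Arguments normalize : simpl never.

Section CurveAut.
Variables (K : closedFieldType) (f : {mpoly K[2]}).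
Hypothesis f8 : f \is 8.-homog.
Implicit Types (x : K * K) (g h : 'M[K]_2 * K).

Lemma fev_scale_pt c x : fev f (scale_pt c x) = c ^+ 8 * fev f x.
Proof.
rewrite !(fev_bform _ f8) /bform big_distrr /=; apply: eq_bigr => i _.
have le : (i <= 8)%N by rewrite -ltnS.
have -> : c ^+ 8 = c ^+ (8 - i) * c ^+ i by rewrite -exprD (subnK le).
by rewrite !exprMn; ring.
Qed.

Lemma on_curve_normalize x y : x != (0, 0) ->
  on_curve f (normalize (x, y)) = (y ^+ 2 == fev f x).
Proof.
move=> x0.
have [c c0] := lift_normalize y x0.
have -> P : on_curve f P = ((lift_pt P).2 ^+ 2 == fev f (lift_pt P).1) by case: P => [[a b]|v].
move->; rewrite /= fev_scale_pt exprMn -exprM (inj_eq (mulfI _)) ?expf_neq0 //.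
Qed.

Definition form_sym g := [/\ g.1 \in unitmx, g.2 != 0 &
  forall x, fev f (mxact g.1 x) = g.2 ^+ 2 * fev f x].

Lemma form_sym1 : form_sym 1.
Proof.
by split=> [||x] /=; rewrite ?unitmx1 ?oner_neq0 // mxact1 expr1n mul1r.
Qed.

Lemma form_symM g h : form_sym g -> form_sym h -> form_sym (g * h).
Proof.
move=> [ug ng gf] [uh nh hf]; split=> [||x] /=.
- by rewrite unitmx_mul ug.
- exact: mulf_neq0.
- by rewrite mxact_mul gf hf exprMn mulrA.
Qed.

Lemma form_symX g n : form_sym g -> form_sym (g ^+ n).
Proof.
move=> lg; elim: n => [|n IH]; first exact: form_sym1.
by rewrite exprS; apply: form_symM.
Qed.

Lemma form_sym_inv g : form_sym g -> form_sym (invmx g.1, g.2^-1).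
Proof.
move=> [ug ng gf]; split=> [||x] /=; rewrite ?unitmx_inv ?invr_eq0 //.
by rewrite -{2}(mxactVK ug x) gf exprVn mulKf // expf_neq0.
Qed.

Definition act_pt g (P : K * K + K) : K * K + K :=
  normalize (mxact g.1 (lift_pt P).1, g.2 * (lift_pt P).2).

(** By val_act_curve, act_pt g preserves the curve when g satisfies form_sym. *)
Definition act_curve g (P : curve f) : curve f := insubd P (act_pt g (val P)).

Lemma on_curve_lift P : on_curve f P -> (lift_pt P).2 ^+ 2 = fev f (lift_pt P).1.
Proof. by case: P => [[a b]|v] /eqP. Qed.

Lemma val_act_curve g P : form_sym g -> val (act_curve g P) = act_pt g (val P).
Proof.
move=> [ug ng gf]; rewrite val_insubd.
rewrite /act_pt on_curve_normalize ?mxact_neq0 ?lift_pt_neq0 //.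
by rewrite exprMn (on_curve_lift (valP P)) gf eqxx.
Qed.

Lemma act_pt_normalize g x y : g.1 \in unitmx -> x != (0, 0) ->
  act_pt g (normalize (x, y)) = normalize (mxact g.1 x, g.2 * y).
Proof.
move=> ug x0; have [c c0 e] := lift_normalize y x0.
rewrite /act_pt e -[LHS]/(normalize (mxact g.1 (scale_pt c x), g.2 * (c ^+ 4 * y))).
by rewrite mxact_scale_pt mulrCA normalize_scale_pt.
Qed.

Lemma act_curveM g h : form_sym g -> form_sym h ->
  act_curve (g * h) =1 act_curve g \o act_curve h.
Proof.
move=> lg lh P; apply: val_inj.
rewrite /= !val_act_curve //; last exact: form_symM.
have [ug _ _] := lg; have [uh _ _] := lh.
by rewrite {3}/act_pt act_pt_normalize ?mxact_neq0 ?lift_pt_neq0 // /act_pt /= mxact_mul mulrA.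
Qed.

Lemma act_curve_wequiv g h : form_sym g -> form_sym h -> wequiv g h ->
  act_curve g =1 act_curve h.
Proof.
move=> lg lh [c c0 e] P; apply: val_inj; rewrite !val_act_curve //.
rewrite /act_pt e /= [c%:M * _]mul_scalar_mx -mul_scalar_mx mxact_mul mxact_scal -mulrA.
by rewrite normalize_scale_pt.
Qed.

Lemma act_curve1 : act_curve 1 =1 id.
Proof.
move=> P; apply: val_inj; rewrite val_act_curve; last exact: form_sym1.
by rewrite /act_pt /= mxact1 mul1r -surjective_pairing lift_ptK.
Qed.

Definition aff_pt (c : bool) (q : K * K) : K * K := if c then (1, q.1) else (q.1, 1).

Lemma chart_normalize c (P : curve f) q : chart c P = Some q ->
  val P = normalize (aff_pt c q, q.2).
Proof.
rewrite /chart /normalize; case: c; case: (val P) => [[a b]|v] //=.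
- have [//|a0] := eqVneq a 0; case=> <- /=.
  by rewrite invr_eq0 a0 /= div1r invrK exprVn invrK divfK // expf_neq0.
- by case=> <- /=; rewrite eqxx /= expr1n divr1.
- by case=> <- /=; rewrite oner_neq0 /= expr1n !divr1.
Qed.

Lemma normalize_chart c (P : curve f) x y : val P = normalize (x, y) ->
  (if c then x.1 else x.2) != 0 ->
  chart c P = Some (if c then x.2 / x.1 else x.1 / x.2,
                    y / (if c then x.1 else x.2) ^+ 4).
Proof.
rewrite /chart => ->; rewrite /normalize; case: c => /= d0; last by rewrite d0.
have [x2|x2] := eqVneq x.2 0; rewrite /= ?x2 ?mul0r //.
rewrite mulf_eq0 invr_eq0 (negPf d0) (negPf x2) /= invf_div; congr (Some (_, _)).
rewrite expr_div_n invf_div -mulrA [_^-1 * _]mulrA mulVf ?mul1r // expf_neq0 //.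
Qed.

(** In the source chart c, the two coordinates of the image are linear forms in the
    coordinates of the source; the target chart c' is chosen so that the one in
    the denominator does not vanish at P. *)
Lemma act_curve_regular g : form_sym g -> regular_map (act_curve g).
Proof.
move=> lg P; have [ug ng gf] := lg.
pose c := if val P is inr _ then true else false.
have [p cp] : exists p, chart c P = Some p.
  rewrite /c /chart; case: (val P) => [xy|v]; [by exists xy | by exists (0, v)].
pose aff (i : 'I_2) : {mpoly K[2]} :=
  if c then (if i == 0 then 1 else 'X_0) else (if i == 0 then 'X_0 else 1).
pose L (i : 'I_2) : {mpoly K[2]} := g.1 i 0 *: aff 0 + g.1 i 1 *: aff 1.
have LE i q : feval (L i) q.1 q.2 = g.1 i 0 * (aff_pt c q).1 + g.1 i 1 * (aff_pt c q).2.
  rewrite /feval mevalD !mevalZ /aff /aff_pt; case: (c) => /=;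
    by rewrite mevalXU meval1 /pt2.
have [c' c'0] : exists c' : bool, feval (L (if c' then 0 else 1)) p.1 p.2 != 0.
  have : mxact g.1 (aff_pt c p) != (0, 0).
    apply: mxact_neq0 => //; rewrite /aff_pt; case: (c);
      by rewrite xpair_eqE oner_eq0 ?andbF.
  rewrite xpair_eqE negb_and -!LE => /orP[h|h]; [by exists true | by exists false].
pose D := L (if c' then 0 else 1); pose N := L (if c' then 1 else 0).
exists c, c', p, (N * D ^+ 3), (g.2 *: 'X_1), (D ^+ 4); split=> //.
  by rewrite /feval rmorphXn /= expf_neq0.
move=> Q q cq; rewrite /feval rmorphXn /= expf_eq0 /= -/(feval D q.1 q.2) => d0.
have vQ := chart_normalize cq.
have vgQ : val (act_curve g Q) = normalize (mxact g.1 (aff_pt c q), g.2 * q.2).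
  rewrite val_act_curve // vQ act_pt_normalize // /aff_pt.
  by case: (c); rewrite xpair_eqE oner_eq0 ?andbF.
have DE : feval D q.1 q.2 = if c' then (mxact g.1 (aff_pt c q)).1 else (mxact g.1 (aff_pt c q)).2.
  by rewrite /D LE; case: (c').
have NE : feval N q.1 q.2 = if c' then (mxact g.1 (aff_pt c q)).2 else (mxact g.1 (aff_pt c q)).1.
  by rewrite /N LE; case: (c').
rewrite (normalize_chart (c := c') vgQ) -?DE // mevalM rmorphXn /= mevalZ mevalXU.
rewrite -!/(feval _ q.1 q.2) /pt2 /=; congr (Some (_, _)).
transitivity (feval N q.1 q.2 / feval D q.1 q.2); first by rewrite DE NE; case: (c').
by move: (feval N _ _) (feval D _ _) d0 => n d d0; field.
Qed.

Lemma act_curve_aut g : form_sym g -> curve_aut (act_curve g).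
Proof.
move=> lg; split; first exact: act_curve_regular.
have lg' := form_sym_inv lg; have [ug ng _] := lg.
exists (act_curve (invmx g.1, g.2^-1)); split; first exact: act_curve_regular.
- move=> P; rewrite -[LHS]/((act_curve _ \o act_curve g) P) -act_curveM //.
  rewrite (_ : _ * g = 1) ?act_curve1 //.
  by rewrite [g in _ * g]surjective_pairing; congr (_, _); rewrite /= ?mulVf // [LHS]mulVmx.
- move=> P; rewrite -[LHS]/((act_curve g \o act_curve _) P) -act_curveM //.
  rewrite (_ : g * _ = 1) ?act_curve1 //.
  by rewrite [g in g * _]surjective_pairing; congr (_, _); rewrite /= ?mulfV // [LHS]mulmxV.
Qed.

(** M fixes every point of the projective line, so it is a scalar v; comparing the
    second coordinates at a point with y nonzero gives e = v^4. *)
Lemma act_curve_id g : f != 0 -> form_sym g -> act_curve g =1 id -> wequiv g 1.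
Proof.
move=> f0 lg gid; have [ug ng gf] := lg.
have root x : exists y, y ^+ 2 = fev f x by apply: nth_root_closed.
have fixn x y : x != (0, 0) -> y ^+ 2 = fev f x ->
    normalize (mxact g.1 x, g.2 * y) = normalize (x, y).
  move=> x0 xy; have oP : on_curve f (normalize (x, y)) by rewrite on_curve_normalize // xy.
  have := congr1 val (gid (exist _ (normalize (x, y)) oP : curve f)).
  by rewrite val_act_curve //= act_pt_normalize.
have fixx x : bracket (mxact g.1 x) x = 0.
  have [->|x0] := eqVneq x (0, 0); first by rewrite /bracket /= !mulr0 subr0.
  have [y xy] := root x; have := congr1 (@lift_pt K) (fixn _ _ x0 xy).
  have [c c0 ->] := lift_normalize y x0.
  have [d d0 ->] := lift_normalize (g.2 * y) (mxact_neq0 ug x0).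
  case=> e1 e2 _; apply: (mulfI (mulf_neq0 c0 d0)); rewrite mulr0.
  transitivity (bracket (scale_pt d (mxact g.1 x)) (scale_pt c x)); first by rewrite bracket_scale_ptl bracket_scale_ptr; ring.
  by rewrite /scale_pt e1 e2 bracketxx.
have [v gv] : exists v, g.1 = v%:M.
  by apply: (@scalar_of_fix3 _ _ (1, 0) (0, 1) (1, 1)) => //;
    rewrite /bracket /= !(mulr1, mulr0, mul0r, subr0, sub0r) ?oppr_eq0 oner_neq0.
have v0 : v != 0.
  by move: ug; rewrite gv unitmx_det det_scalar expf_eq0.
have [x fx] := fev_nonroot f8 f0.
have x0 : x != (0, 0).
  apply: contraNneq fx => ->; rewrite -[(0, 0)](_ : scale_pt 0 (0, 0) = _) ?fev_scale_pt ?expr0n ?mul0r //.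
  by rewrite /scale_pt /= mul0r.
have [y xy] := root x.
have y0 : y != 0 by apply: contraNneq fx => y0; rewrite -xy y0 expr0n.
exists v => //; rewrite mulr1 [LHS]surjective_pairing gv; congr (_, _).
have := fixn _ _ x0 xy; rewrite gv mxact_scal -(normalize_scale_pt x y v0).
by move/(normalize_inj (scale_pt_neq0 v0 x0))/(mulIf y0).
Qed.

End CurveAut.

Section Embed.
Variables (K : closedFieldType) (f : {mpoly K[2]}).
Hypotheses (f8 : f \is 8.-homog) (f0 : f != 0).

Lemma aut_embed (gT : finGroupType) (G : {group gT}) (rho : gT -> 'M[K]_2 * K) :
  (forall a, a \in G -> form_sym f (rho a)) ->
  (forall a b, a \in G -> b \in G -> wequiv (rho (a * b)%g) (rho a * rho b)) ->
  (forall a, a \in G -> wequiv (rho a) 1 -> a = 1%g) ->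
  aut_has_subgroup f G.
Proof.
move=> lau hom ker; exists (fun a => act_curve (f := f) (rho a)).
have homc a b : a \in G -> b \in G ->
    act_curve (f := f) (rho (a * b)%g) =1 act_curve (rho a) \o act_curve (rho b).
  move=> Ga Gb P; rewrite -act_curveM //; try exact: lau.
  apply: act_curve_wequiv (hom _ _ Ga Gb) _ => //; first by apply: lau; apply: groupM.
  by apply: form_symM; apply: lau.
split=> // [a Ga|a b Ga Gb ab]; first exact: act_curve_aut (lau _ Ga).
have Gab : (a^-1 * b)%g \in G by rewrite groupM ?groupV.
apply/eqP; rewrite eq_mulVg1; apply/eqP/ker => //.
apply: (act_curve_id f8 f0 (lau _ Gab)) => P.
rewrite homc ?groupV //= -ab -[LHS]/((act_curve (rho a^-1%g) \o act_curve (rho a)) P).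
rewrite -homc ?groupV // mulVg.
have e1 : wequiv (rho 1%g) 1.
  have := hom _ _ (group1 G) (group1 G); rewrite mulg1 => /wequiv_sym[c c0 e].
  have [u1 n1 _] := lau _ (group1 G); exists c => //.
  have ur : rho 1%g \is a GRing.unit.
    by apply/andP; rewrite [rho 1%g]surjective_pairing /= unitfE.
  by apply: (mulIr ur); rewrite e mulr1.
rewrite (act_curve_wequiv f8 (lau _ (group1 G)) (form_sym1 f) e1).
exact: act_curve1.
Qed.

End Embed.

Section EmbedConj.
Variables (K : closedFieldType) (f : {mpoly K[2]}) (P : 'M[K]_2).
Hypotheses (f8 : f \is 8.-homog) (f0 : f != 0) (uP : P \in unitmx).

(** The symmetries may be given in the coordinates where f has a normal form, as they
    can be conjugated back as matrices. *)
Lemma aut_embed_conj (gT : finGroupType) (G : {group gT}) (rho : gT -> 'M[K]_2 * K) :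
  (forall a, a \in G -> form_sym (form_act P f) (rho a)) ->
  (forall a b, a \in G -> b \in G -> wequiv (rho (a * b)%g) (rho a * rho b)) ->
  (forall a, a \in G -> wequiv (rho a) 1 -> a = 1%g) ->
  aut_has_subgroup f G.
Proof.
move=> lau hom ker.
pose p : 'M[K]_2 * K := (P, 1); pose p' : 'M[K]_2 * K := (invmx P, 1).
have pp' : p * p' = 1 by congr (_, _); rewrite /= ?mulr1 // [LHS]mulmxV.
have p'p : p' * p = 1 by congr (_, _); rewrite /= ?mulr1 // [LHS]mulVmx.
have cE (g : 'M[K]_2 * K) x : mxact (p' * g * p).1 x = mxact (invmx P) (mxact g.1 (mxact P x)).
  by rewrite /= !mxact_mul.
apply: (@aut_embed _ f f8 f0 _ _ (fun a => p' * rho a * p)).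
- move=> a /lau[ua na fa]; split=> [||x].
  + by rewrite /= !unitmx_mul unitmx_inv uP ua.
  + by rewrite /= mul1r mulr1.
  + by rewrite cE -fev_act fa fev_act mxactK //= mul1r mulr1.
- move=> a b Ga Gb; have -> : p' * rho a * p * (p' * rho b * p) = p' * (rho a * rho b) * p.
    by rewrite !mulrA -(mulrA _ p p') pp' mulr1.
  apply: wequivM; last exact: wequiv_refl.
  by apply: wequivM; [exact: wequiv_refl | exact: hom].
- move=> a Ga e; apply: ker => //.
  have := wequivM (wequivM (wequiv_refl p) e) (wequiv_refl p').
  by rewrite mulr1 pp' !mulrA pp' mul1r -mulrA pp' mulr1.
Qed.

End EmbedConj.

(** * Dihedral groups *)

(** Every element is x^i y^j with i < q and j < 2, and the order of the group makes
    these exponents unique; they are n and b. *)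
Lemma dihedral_coordinates q : (1 < q)%N ->
  exists (n : 'D_(q.*2) -> nat) (b : 'D_(q.*2) -> bool),
    [/\ forall g h, n g = n h %[mod q] -> b g = b h -> g = h,
        forall g h, b (g * h)%g = b g (+) b h &
        forall g h, n (g * h)%g = n g + (if b g then q.-1 * n h else n h) %[mod q]].
Proof.
move=> q1; have q0 : (0 < q)%N by apply: ltnW.
have : ([set: 'D_(q.*2)] \homg [set: 'D_(q.*2)])%g by apply: homg_refl.
rewrite (Grp_dihedral q1) => /existsP[[x y]] /=; rewrite !xpair_eqE => /and4P[/eqP defG /eqP xq /eqP y2 /eqP xy].
have yx k : (y * x ^+ k = x ^+ (q.-1 * k) * y)%g.
  have xV : (x ^+ q.-1 = x^-1)%g.
    by apply/eqP; rewrite eq_sym eq_invg_mul -expgS prednK // xq.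
  by rewrite expgM xV [RHS]conjgC conjXg conjVg xy invgK.
pose w (ij : 'I_q * bool) := (x ^+ ij.1 * y ^+ ij.2)%g.
have wE i j : (x ^+ i * y ^+ j)%g = w (Ordinal (ltn_pmod i q0), odd j).
  rewrite /w /= expg_mod //; congr (_ * _)%g.
  transitivity (y ^+ (odd j + j./2.*2))%g; first by rewrite odd_double_half.
  by rewrite expgD -[j./2.*2]muln2 [(j./2 * 2)%N]mulnC expgM y2 expg1n mulg1.
have wsurj g : exists ij, w ij = g.
  have : g \in (<[x]> * <[y]>)%g.
    by rewrite -norm_joinEr ?defG ?inE // norms_cycle xy groupV cycle_id.
  case/mulsgP=> _ _ /cycleP[i ->] /cycleP[j ->] ->.
  by exists (Ordinal (ltn_pmod i q0), odd j); rewrite -wE.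
have winj : injective w.
  apply/injectiveP; have /image_injP wi : #|codom w| == #|{: 'I_q * bool}|.
    rewrite (eq_card (B := [set: 'D_(q.*2)])) ?card_dihedral //; last first.
      by move=> g; rewrite !inE; apply/codomP; have [ij <-] := wsurj g; exists ij.
    by rewrite card_prod card_ord card_bool muln2.
  by apply/injectiveP => ij kl; apply: wi.
have [c cE] := fin_all_exists wsurj.
have cw ij : c (w ij) = ij by apply: winj; rewrite cE.
have cM g h : c (g * h)%g = (Ordinal (ltn_pmod
    ((c g).1 + (if (c g).2 then q.-1 * (c h).1 else (c h).1)) q0), (c g).2 (+) (c h).2).
  rewrite -[in LHS](cE g) -[in LHS](cE h) {1 2}/w.
  case: (c g) (c h) => [i j] [k l] /=.
  have -> : (x ^+ i * y ^+ j * (x ^+ k * y ^+ l) =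
             x ^+ (i + (if j then q.-1 * k else k))%N * y ^+ (j + l)%N)%g.
    rewrite !expgD !mulgA; congr (_ * _)%g; rewrite -!mulgA; congr (_ * _)%g.
    by case: j; rewrite ?expg1 ?yx //= expg0 mul1g mulg1.
  by rewrite wE cw oddD !oddb.
exists (fun g => (c g).1 : nat), (fun g => (c g).2); split.
- move=> g h; rewrite !modn_small // => e1 e2; rewrite -(cE g) -(cE h); congr w.
  by rewrite (surjective_pairing (c g)) (surjective_pairing (c h)) e2; congr (_, _); apply: val_inj.
- by move=> g h; rewrite cM.
- by move=> g h; rewrite cM /= modn_mod.
Qed.

Section DihedralHom.
Variable K : closedFieldType.

(** A homomorphism up to scalars, sending the rotation to R and the reflection to S.
    The form given to its values lets its kernel be computed from R and S. *)
Lemma dihedral_hom q (R S : 'M[K]_2 * K) : (1 < q)%N ->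
  wequiv (R ^+ q) 1 -> wequiv (S ^+ 2) 1 -> wequiv (S * R) (R ^+ q.-1 * S) ->
  exists rho : 'D_(q.*2) -> 'M[K]_2 * K,
    (forall a, exists i (j : bool), rho a = R ^+ i * S ^+ j /\
       ((q %| i)%N -> j = false -> a = 1%g)) /\
    forall a b, wequiv (rho (a * b)%g) (rho a * rho b).
Proof.
move=> q1 Rq S2 SR; have [n [b [inj bM nM]]] := dihedral_coordinates q1.
have SRk k : wequiv (S * R ^+ k) (R ^+ (q.-1 * k) * S).
  elim: k => [|k IH]; first by rewrite muln0 !expr0 mulr1 mul1r; apply: wequiv_refl.
  rewrite exprSr mulrA; apply: (wequiv_trans (wequivM IH (wequiv_refl R))).
  rewrite -mulrA mulnS addnC exprD -!mulrA.
  by apply: wequivM SR; exact: wequiv_refl.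
exists (fun g => R ^+ n g * S ^+ b g); split.
  move=> a; exists (n a), (b a); split=> // qa ba.
  have b1 : b 1%g = false by have := bM 1%g 1%g; rewrite mulg1; case: (b 1%g).
  have n1 : n 1%g = 0 %[mod q].
    apply/eqP; rewrite -(eqn_modDl (n 1%g)) addn0 eq_sym.
    by have := nM 1%g 1%g; rewrite mulg1 b1 => /eqP.
  by apply: inj; rewrite ?ba ?b1 // n1 mod0n; apply/eqP.
move=> g h; rewrite bM -!mulrA.
apply: (wequiv_trans (wequivM (wequivX_mod Rq (nM g h)) (wequiv_refl _))).
rewrite exprD -mulrA; apply: wequivM; first exact: wequiv_refl.
case: (b g); last by rewrite expr0 mul1r; apply: wequiv_refl.
rewrite expr1 mulrA.
apply: wequiv_trans (wequivM (wequiv_sym (SRk _)) (wequiv_refl _)).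
rewrite -mulrA; apply: wequivM; first exact: wequiv_refl.
case: (b h); rewrite /= ?expr0 ?expr1 ?mulr1; last exact: wequiv_refl.
by rewrite -expr2; apply: wequiv_sym.
Qed.

Lemma mk2X (a d e : K) n : (mk2 a 0 0 d, e) ^+ n = (mk2 (a ^+ n) 0 0 (d ^+ n), e ^+ n).
Proof.
elim: n => [|n IH].
  by rewrite !expr0; congr (_, _); apply: mx2P; rewrite !mxE.
rewrite exprS IH; congr (_, _); rewrite /= -?exprS //.
by apply: mx2P; rewrite [LHS]mxE sum2 !mxE /= ?exprS; ring.
Qed.

Lemma mk2M (a b c d a' b' c' d' : K) : mk2 a b c d * mk2 a' b' c' d' =
  mk2 (a * a' + b * c') (a * b' + b * d') (c * a' + d * c') (c * b' + d * d').
Proof. by apply: mx2P; rewrite [LHS]mxE sum2 !mxE. Qed.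

Lemma wequiv1_mk2 (a b c d e : K) : wequiv (mk2 a b c d, e) 1 ->
  [/\ a != 0, b = 0, d = a & e = a ^+ 4].
Proof.
case=> v v0; rewrite mulr1 => -[/matrixP E ->].
by move: (E 0 0) (E 0 1) (E 1 1); rewrite !mxE /= => -> -> ->; split.
Qed.

End DihedralHom.

(** * The three normal forms *)

Section NormalForms.
Variables (K : closedFieldType) (f : {mpoly K[2]}) (P : 'M[K]_2).
Hypotheses (f8 : f \is 8.-homog) (f0 : f != 0) (uP : P \in unitmx).
Hypothesis two0 : 2%:R != 0 :> K.

Let F := fpoly 8 (form_act P f).

Let fevF y : fev (form_act P f) y = bform 8 F y.
Proof. by rewrite (fev_bform _ (form_act_homog _ f8)). Qed.

Lemma sign_even n : (-1 : K) ^+ n = 1 -> (2 %| n)%N.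
Proof.
rewrite -signr_odd dvdn2; case: (odd n) => // /eqP.
by rewrite expr1 eq_sym -subr_eq0 opprK -[1 + 1]/(2%:R) (negPf two0).
Qed.

Lemma form_sym_mk2 (a b c d e : K) : a * d - b * c != 0 -> e != 0 ->
  (forall y, bform 8 F (a * y.1 + b * y.2, c * y.1 + d * y.2) = e ^+ 2 * bform 8 F y) ->
  form_sym (form_act P f) (mk2 a b c d, e).
Proof.
move=> dt e0 H; split=> [||y] //=; first by rewrite unitmx_det det_mk2.
by rewrite mxact_mk2 !fevF H.
Qed.

(** The form is F_1 x^7 z + F_4 x^4 z^4 + F_7 x z^7.  The rotation of order 3 given by
    r, times the hyperelliptic involution, has order 6; the reflection exchanges x
    and z, rescaled by a sixth root of F_7 / F_1. *)
Lemma embed_D12 (r : K) : r ^+ 3 = 1 -> r != 1 ->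
  (forall i, (i <= 8)%N -> F`_i != 0 -> (i %% 3 = 1)%N) -> F`_1 != 0 -> F`_7 != 0 ->
  aut_has_subgroup f ('D_12)%G.
Proof.
move=> r3 r1 supp F1 F7.
have z i : (i <= 8)%N -> (i %% 3 != 1)%N -> F`_i = 0.
  by move=> i8 i3; apply/eqP; apply: contraNT i3 => Fi; rewrite (supp _ i8 Fi).
have hE y : bform 8 F y = F`_1 * (y.1 ^+ 7 * y.2) + F`_4 * (y.1 ^+ 4 * y.2 ^+ 4) + F`_7 * (y.1 * y.2 ^+ 7).
  rewrite /bform !big_ord_recl big_ord0 /= /bump /=.
  rewrite (z 0%N) // (z 2%N) // (z 3%N) // (z 5%N) // (z 6%N) // (z 8%N) //; ring.
(* the exchange x |-> g z, z |-> x / g maps F_1 x^7 z to F_7 x z^7 *)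
have [g g6] := nth_root_closed (F`_7 / F`_1) (isT : 0 < 6)%N.
have g0 : g != 0.
  have : g ^+ 6 != 0 by rewrite g6 mulf_neq0 ?invr_eq0.
  by rewrite expf_eq0.
have r0 : r != 0 by apply/eqP => e; move/eqP: r3; rewrite e expr0n /= eq_sym oner_eq0.
pose R : 'M[K]_2 * K := (mk2 (r ^+ 2) 0 0 r, -1).
pose S : 'M[K]_2 * K := (mk2 0 g g^-1 0, 1).
have lR : form_sym (form_act P f) R.
  apply: form_sym_mk2; rewrite ?oppr_eq0 ?oner_neq0 //.
    by rewrite mulr0 subr0 -exprSr r3 oner_neq0.
  move=> y; rewrite !hE /=.
  transitivity (F`_1 * ((r ^+ 3) ^+ 5 * y.1 ^+ 7 * y.2) + F`_4 * ((r ^+ 3) ^+ 4 * y.1 ^+ 4 * y.2 ^+ 4)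
     + F`_7 * ((r ^+ 3) ^+ 3 * y.1 * y.2 ^+ 7)); first by ring.
  by rewrite r3 !expr1n; ring.
have F7E : F`_7 = F`_1 * g ^+ 6 by rewrite g6 mulrCA mulfV ?mulr1.
have gV : g * g^-1 = 1 by rewrite mulfV.
have lS : form_sym (form_act P f) S.
  apply: form_sym_mk2; rewrite ?oner_neq0 //.
    by rewrite mul0r sub0r gV oppr_eq0 oner_neq0.
  move=> y; rewrite !hE /= F7E.
  transitivity (F`_1 * (g ^+ 6 * (g * g^-1) * y.1 * y.2 ^+ 7) + F`_4 * ((g * g^-1) ^+ 4 * y.1 ^+ 4 * y.2 ^+ 4)
     + F`_1 * ((g * g^-1) ^+ 7 * y.1 ^+ 7 * y.2)); first by ring.
  by rewrite gV !expr1n; ring.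
have [||||rho [rhoE rhoM]] := @dihedral_hom K 6 R S.
- by [].
- rewrite mk2X -exprM (_ : (2 * 6 = 3 * 4)%N) // exprM r3 expr1n (_ : r ^+ 6 = 1).
    by rewrite (_ : (_, _) = 1); [exact: wequiv_refl | congr (_, _); [apply: mx2P; rewrite !mxE | rewrite !exprS expr0; ring]].
  by rewrite (exprM r 3 2) r3 expr1n.
- rewrite expr2 (_ : S * S = 1); first exact: wequiv_refl.
  congr (_, _); last by rewrite /= mulr1.
  by rewrite /= mk2M; apply: mx2P; rewrite !mxE /= ?(mulr0, mul0r, addr0, add0r) // mulrC.
- rewrite mk2X (_ : S * R = (mk2 ((r ^+ 2) ^+ 5) 0 0 (r ^+ 5), (-1) ^+ 5) * S).
    exact: wequiv_refl.
  congr (_, _); last by rewrite /= !exprS expr0; ring.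
  rewrite /= !mk2M; congr mk2; rewrite ?(mulr0, mul0r, addr0, add0r) //.
    by transitivity (r ^+ 3 * r ^+ 3 * r ^+ 3 * (g * r)); [rewrite r3 !mul1r | ring].
  by transitivity (r ^+ 3 * (r ^+ 2 * g^-1)); [rewrite r3 mul1r mulrC | ring].
apply: (aut_embed_conj f8 f0 uP (rho := rho)).
- by move=> a _; have [i [j [-> _]]] := rhoE a; apply: form_symM; apply: form_symX.
- by move=> a b _ _; apply: rhoM.
move=> a _; have [i [j [-> H]]] := rhoE a; rewrite mk2X.
case: j H => H.
  rewrite expr1 => e; exfalso; move: e; rewrite [_ * S](_ : _ = (mk2 0 ((r ^+ 2) ^+ i * g) (r ^+ i * g^-1) 0, (-1) ^+ i)).
    by case/wequiv1_mk2; rewrite eqxx.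
  congr (_, _); last by rewrite /= mulr1.
  by rewrite /= mk2M; congr mk2; ring.
rewrite expr0 mulr1 => /wequiv1_mk2[_ _ e1 e2]; apply: H => //.
have ri : r ^+ i = 1.
  move: e1; rewrite -exprM mulnC exprM expr2 => /eqP.
  by rewrite -[X in X == _]mul1r (inj_eq (mulIf _)) ?expf_neq0 // => /eqP.
rewrite [(r ^+ 2) ^+ i]exprAC ri !expr1n in e2.
have i2 := sign_even e2.
have i3 : (3 %| i)%N.
  move: ri; rewrite {1}(divn_eq i 3) exprD mulnC exprM r3 expr1n mul1r /dvdn.
  have := ltn_pmod i (isT : 0 < 3)%N; case: (i %% 3)%N => [|[|[|//]]] // _.
    by rewrite expr1 => e; rewrite e eqxx in r1.
  move=> e; move: r3; rewrite exprS e mulr1 => e'; by rewrite e' eqxx in r1.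
by rewrite (@Gauss_dvd 2 3) // i2.
Qed.

(** The form is F_0 x^8 + F_4 x^4 z^4 + F_8 z^8.  The dihedral group of order 8 is
    generated by x |-> r x and by the exchange of x and z, rescaled by an eighth
    root of F_8 / F_0; the other factor is the hyperelliptic involution J. *)
Lemma embed_C2xD8 (r : K) : r ^+ 4 = 1 -> (forall i, r ^+ i = 1 -> (4 %| i)%N) ->
  (forall i, (i <= 8)%N -> F`_i != 0 -> (i %% 4 = 0)%N) -> F`_0 != 0 -> F`_8 != 0 ->
  aut_has_subgroup f (setX_group [set: 'Z_2]%G ('D_8)%G).
Proof.
move=> r4 r_ord supp F0 F8.
have z i : (i <= 8)%N -> (i %% 4 != 0)%N -> F`_i = 0.
  by move=> i8 i3; apply/eqP; apply: contraNT i3 => Fi; rewrite (supp _ i8 Fi).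
have hE y : bform 8 F y = F`_0 * y.1 ^+ 8 + F`_4 * (y.1 ^+ 4 * y.2 ^+ 4) + F`_8 * y.2 ^+ 8.
  rewrite /bform !big_ord_recl big_ord0 /= /bump /=.
  rewrite (z 1%N) // (z 2%N) // (z 3%N) // (z 5%N) // (z 6%N) // (z 7%N) //; ring.
(* the exchange x |-> g z, z |-> x / g maps F_0 x^8 to F_8 z^8 *)
have [g g8] := nth_root_closed (F`_8 / F`_0) (isT : 0 < 8)%N.
have g0 : g != 0.
  have : g ^+ 8 != 0 by rewrite g8 mulf_neq0 ?invr_eq0.
  by rewrite expf_eq0.
have r0 : r != 0 by apply/eqP => e; move/eqP: r4; rewrite e expr0n /= eq_sym oner_eq0.
pose R : 'M[K]_2 * K := (mk2 r 0 0 1, 1).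
pose S : 'M[K]_2 * K := (mk2 0 g g^-1 0, 1).
pose J : 'M[K]_2 * K := (mk2 1 0 0 1, -1).
have lR : form_sym (form_act P f) R.
  apply: form_sym_mk2; rewrite ?oner_neq0 //; first by rewrite mulr0 subr0 mulr1.
  move=> y; rewrite !hE /=.
  transitivity (F`_0 * ((r ^+ 4) ^+ 2 * y.1 ^+ 8) + F`_4 * (r ^+ 4 * y.1 ^+ 4 * y.2 ^+ 4)
     + F`_8 * y.2 ^+ 8); first by ring.
  by rewrite r4 !expr1n; ring.
have F8E : F`_8 = F`_0 * g ^+ 8 by rewrite g8 mulrCA mulfV ?mulr1.
have gV : g * g^-1 = 1 by rewrite mulfV.
have lS : form_sym (form_act P f) S.
  apply: form_sym_mk2; rewrite ?oner_neq0 //.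
    by rewrite mul0r sub0r gV oppr_eq0 oner_neq0.
  move=> y; rewrite !hE /= F8E.
  transitivity (F`_0 * (g ^+ 8 * y.2 ^+ 8) + F`_4 * ((g * g^-1) ^+ 4 * y.1 ^+ 4 * y.2 ^+ 4)
     + F`_0 * ((g * g^-1) ^+ 8 * y.1 ^+ 8)); first by ring.
  by rewrite gV !expr1n; ring.
have lJ : form_sym (form_act P f) J.
  apply: form_sym_mk2; rewrite ?oppr_eq0 ?oner_neq0 //.
    by rewrite mulr0 subr0 mulr1 oner_neq0.
  by move=> y; rewrite !mul1r !mul0r addr0 add0r -surjective_pairing sqrrN expr1n mul1r.
have JE : J = (1, -1) by congr (_, _); apply: mx2P; rewrite !mxE.
have Jcomm h : h * J = J * h by case: h => M e; rewrite JE; congr (_, _); rewrite /= ?mulr1 ?mul1r // mulrC.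
have J2 : J ^+ 2 = 1 by rewrite JE expr2; congr (_, _); rewrite /= ?mulr1 // mulN1r opprK.
have [||||rho [rhoE rhoM]] := @dihedral_hom K 4 R S.
- by [].
- rewrite mk2X r4 !expr1n (_ : (_, _) = 1); first exact: wequiv_refl.
  by congr (_, _); apply: mx2P; rewrite !mxE.
- rewrite expr2 (_ : S * S = 1); first exact: wequiv_refl.
  congr (_, _); last by rewrite /= mulr1.
  by rewrite /= mk2M; apply: mx2P; rewrite !mxE /= ?(mulr0, mul0r, addr0, add0r) // mulrC.
- exists r => //; rewrite mk2X; congr (_, _); last by rewrite /= r4 !expr1n !mulr1.
  rewrite /= !mk2M (_ : r%:M = mk2 r 0 0 r); last by apply: mx2P; rewrite !mxE.
  rewrite mk2M; congr mk2; rewrite ?expr1n; try ring.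
  by transitivity (r ^+ 4 * g); [rewrite r4; ring | ring].
apply: (aut_embed_conj f8 f0 uP (rho := fun a : 'Z_2 * 'D_8 => J ^+ a.1 * rho a.2)).
- move=> a _; have [i [j [-> _]]] := rhoE a.2.
  by apply: form_symM; [|apply: form_symM]; apply: form_symX.
- move=> [k a] [l b] _ _ /=.
  have -> : J ^+ k * rho a * (J ^+ l * rho b) = J ^+ (k + l) * (rho a * rho b).
    rewrite exprD -!mulrA; congr (_ * _); rewrite !mulrA; congr (_ * _).
    by apply: commrX; apply: Jcomm.
  apply: wequivM (rhoM _ _).
  have -> : J ^+ (k * l)%g = J ^+ (k + l); last exact: wequiv_refl.
  by rewrite [LHS](expr_mod _ J2).
move=> [k a] _ /=; have [i [j [-> H]]] := rhoE a; rewrite !mk2X !expr1n.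
case: j H => H.
  rewrite expr1 => e; exfalso; move: e; rewrite [_ * (_ * S)](_ : _ = (mk2 0 (r ^+ i * g) g^-1 0, (-1) ^+ k)).
    by case/wequiv1_mk2; rewrite eqxx.
  congr (_, _); last by rewrite /= !mulr1.
  by rewrite /= !mk2M; congr mk2; ring.
rewrite expr0 mulr1 => e; move: e; rewrite [_ * _](_ : _ = (mk2 (r ^+ i) 0 0 1, (-1) ^+ k)); last first.
  congr (_, _); last by rewrite /= !mulr1.
  by rewrite /= !mk2M; congr mk2; ring.
case/wequiv1_mk2 => _ _ e1 e2.
rewrite -e1 expr1n in e2; rewrite (H (r_ord _ (esym e1)) erefl); congr (_, _).
have := sign_even e2; case: k {e2} => [[|[|//]] hk] // _; exact: val_inj.
Qed.

End NormalForms.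

Section Cyclic.
Variables (K : closedFieldType) (f : {mpoly K[2]}).
Hypotheses (f8 : f \is 8.-homog) (f0 : f != 0).
Hypothesis two0 : 2%:R != 0 :> K.

(** Choosing the sign of e with e^7 = -1 combines M with the hyperelliptic
    involution. *)
Lemma embed_C14 (M : 'M[K]_2) l : M \in unitmx -> M ^+ 7 = 1 ->
  (forall k c, M ^+ k = c%:M -> (7 %| k)%N) ->
  (forall x, fev f (mxact M x) = l * fev f x) ->
  aut_has_subgroup f [set: 'Z_14]%G.
Proof.
move=> uM M7 Mord Mf.
have [x fx] := fev_nonroot f8 f0.
have l7 : l ^+ 7 = 1.
  have E n y : fev f (mxact (M ^+ n) y) = l ^+ n * fev f y.
    elim: n y => [|n IH] y; first by rewrite expr0 mul1r mxact1.
    by rewrite exprSr -mulmxE mxact_mul IH Mf exprSr mulrA.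
  by apply: (mulIf fx); rewrite -E M7 mxact1 mul1r.
have [e0 e02] := nth_root_closed l (isT : 0 < 2)%N.
(* e0^14 = l^7 = 1, so e0^7 is a sign *)
have [e [e2 e7]] : exists e, e ^+ 2 = l /\ e ^+ 7 = -1.
  have : (e0 ^+ 7) ^+ 2 == 1 by rewrite exprAC e02 l7.
  rewrite sqrf_eq1 => /orP[/eqP e|/eqP e]; last by exists e0.
  exists (- e0); rewrite sqrrN; split=> //.
  by transitivity (- (e0 ^+ 7)); [ring | rewrite e].
have e_neq0 : e != 0.
  by apply/eqP => ee; move/eqP: e7; rewrite ee expr0n eq_sym oppr_eq0 oner_eq0.
pose G : 'M[K]_2 * K := (M, e).
have GX n : G ^+ n = (M ^+ n, e ^+ n).
  by elim: n => [|n IH]; rewrite ?expr0 // !exprS IH.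
have G14 : G ^+ 14 = 1.
  rewrite GX (exprM M 7 2) M7 (exprM e 7 2) e7 expr1n; congr (_, _).
  by rewrite sqrrN expr1n.
apply: (aut_embed f8 f0 (rho := fun k : 'Z_14 => G ^+ k)).
- by move=> k _; apply: form_symX; split=> //= y; rewrite Mf e2.
- by move=> a b _ _; rewrite -exprD [X in wequiv X _](expr_mod _ G14); apply: wequiv_refl.
move=> k _ [c c0]; rewrite mulr1 GX => -[Mk ek].
have [j kj] := dvdnP (Mord _ _ Mk).
have kl : (k < 14)%N := ltn_ord k; apply: val_inj => /=; rewrite kj.
case: j kj => [//|[|j]] kj; last by exfalso; move: kl; rewrite kj; lia.
move: Mk ek; rewrite kj mul1n M7 e7 => /(congr1 (fun X : 'M[K]_2 => X 0 0)).
rewrite !mxE /= !mulr1n => <- /eqP; rewrite expr1n eq_sym -subr_eq0 opprK -[1 + 1]/(2%:R).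
by rewrite (negPf two0).
Qed.

End Cyclic.

(** * Elements of the reduced automorphism group *)

Section Roots.
Variable K : closedFieldType.
Implicit Types (f : {mpoly K[2]}) (u : 'I_8 -> K * K) (M : 'M[K]_2).

(** Each of the eight given zeros is a multiple of some root in a factorisation, and
    distinct zeros belong to distinct roots, so all the roots are obtained. *)
Lemma distinct_roots_factor f : distinct_roots 8 f ->
  exists2 u, pairwise_indep u & forall x, fev f x = \prod_i bracket x (u i).
Proof.
move=> [f8 f0 [p [p0 pp fp]]].
have [u fu] := fev_factor (isT : 0 < 8)%N f8; exists u => //.
have u0 i : u i != (0, 0).
  have [x] := fev_nonroot f8 f0; rewrite fu; apply: contraNneq => ui.
  by rewrite (bigD1 i) //= ui {1}/bracket /= !mulr0 subr0 mul0r.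
have brp i j : i != j -> bracket (p i) (p j) != 0.
  by move/pp; rewrite /bracket subr_eq0 [(p i).2 * _]mulrC.
have /fin_all_exists [c cE] : forall j, exists ic : 'I_8 * K, u ic.1 = scale_pt ic.2 (p j).
  move=> j; have : \prod_i bracket (p j) (u i) == 0 by rewrite -fu; apply/eqP/fp.
  by case/prodf_eq0 => i _ /eqP /(bracket_eq0_scale_pt (p0 j)) [a e]; exists (i, a).
have c0 j : (c j).2 != 0.
  by apply: contraNneq (u0 (c j).1) => e; rewrite cE e /scale_pt !mul0r.
have cinj : injective (fun j => (c j).1).
  move=> j k e; apply/eqP; apply: contraT => /brp h.
  have := bracketxx (u (c j).1); rewrite {2}e !cE bracket_scale_ptl bracket_scale_ptr => /eqP.
  by rewrite !mulf_eq0 (negPf (c0 j)) (negPf (c0 k)) (negPf h).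
have [c' _ c'K] := injF_bij cinj.
move=> i k ik; rewrite -(c'K i) -(c'K k) !cE bracket_scale_ptl bracket_scale_ptr !mulf_neq0 //.
by apply: brp; apply: contraNneq ik => e; rewrite -(c'K i) e c'K.
Qed.

Lemma realizes_eigen f u M s : pairwise_indep u ->
  (forall x, fev f x = \prod_i bracket x (u i)) -> realizes u M s ->
  exists l, forall x, fev f (mxact M x) = l * fev f x.
Proof.
move=> iu fu hM; have [mu _ Hmu] := moves_scale iu (pairwise_indep_perm s iu) hM.
exists (\prod_i (mu i * \det M)) => x.
rewrite !fu (reindex_inj (@perm_inj _ s)) -big_split /=; apply: eq_bigr => i _.
by rewrite Hmu bracket_scale_ptr bracket_mxact mulrA.
Qed.

Lemma realizesX u M s k : pairwise_indep u -> realizes u M s ->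
  realizes u (M ^+ k) (s ^+ k)%g.
Proof.
move=> iu hM; elim: k => [|k IH]; first exact: realizes1.
by rewrite exprS expgSr; apply: realizesM.
Qed.

Lemma realizes_scalar u c s : pairwise_indep u -> realizes u c%:M s -> s = 1%g.
Proof.
move=> iu [uc H]; have c0 : c != 0.
  by move: uc; rewrite unitmx_det det_scalar expf_eq0.
apply/permP => i; rewrite perm1; apply/eqP; apply: contraT => /iu.
have := H i; rewrite mxact_scal bracket_scale_ptl bracketC => /eqP.
by rewrite mulf_eq0 (negPf c0) oppr_eq0 => /eqP->; rewrite eqxx.
Qed.

(** M^n fixes the eight roots, so it is scalar, and an n-th root of this scalar can be
    divided out. *)
Lemma realizes_order u M s : pairwise_indep u -> realizes u M s ->
  exists N, [/\ realizes u N s, N ^+ #[s]%g = 1 &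
                forall k c, N ^+ k = c%:M -> (#[s]%g %| k)%N].
Proof.
move=> iu hM; set n := #[s]%g.
have [v vE] : exists v, M ^+ n = v%:M.
  apply: (fix8_scalar iu) => i.
  by have [_ /(_ i)] := realizesX n iu hM; rewrite expg_order perm1.
have v0 : v != 0.
  have [+ _] := realizesX n iu hM.
  by rewrite vE unitmx_det det_scalar expf_eq0.
have [r rE] := nth_root_closed v (order_gt0 s : 0 < n)%N.
have r0 : r != 0.
  by apply: contraNneq v0 => r0; rewrite -rE r0 expr0n eqn0Ngt order_gt0.
have hN : realizes u (r^-1 *: M) s.
  have [uM H] := hM; split=> [|i].
    by rewrite unitmxZ // unitfE invr_eq0.
  by rewrite -mul_scalar_mx mxact_mul mxact_scal bracket_scale_ptl H mulr0.
exists (r^-1 *: M); split=> //.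
  by rewrite exprZn vE exprVn rE scale_scalar_mx mulVf.
move=> k c e; rewrite order_dvdn; apply/eqP.
by apply: (@realizes_scalar u c) => //; rewrite -e; apply: realizesX.
Qed.

(** In coordinates where the symmetry is diag (a, d), the monomials of the form have the
    same eigenvalue, so their exponents agree modulo the order n of r = d / a.  The
    form has no double root at the two fixed points, hence the nonzero coefficients
    at both ends. *)
Lemma diagonal_normal_form f u M s n : f \is 8.-homog -> pairwise_indep u ->
  (forall x, fev f x = \prod_i bracket x (u i)) -> realizes u M s -> #[s]%g = n ->
  n%:R != 0 :> K ->
  exists (P : 'M[K]_2) (r : K), let F := fpoly 8 (form_act P f) in
    P \in unitmx /\
    [/\ r ^+ n = 1, forall k, r ^+ k = 1 -> (n %| k)%N,
        F`_0 != 0 \/ F`_1 != 0, F`_8 != 0 \/ F`_7 != 0 &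
        forall i j, (i <= 8)%N -> (j <= 8)%N -> F`_i != 0 -> F`_j != 0 -> i = j %[mod n]].
Proof.
move=> f8 iu fu /(realizes_order iu) [N [hN Nn Nord]] sn n0; rewrite sn in Nn Nord.
have n_gt0 : (0 < n)%N by rewrite -sn order_gt0.
have [P [a [d [uP PN]]]] := unity_diagonalization Nn n0.
have dP : \det P != 0 by rewrite -unitmx_det.
have PNk k : P *m N ^+ k = mk2 (a ^+ k) 0 0 (d ^+ k) *m P.
  elim: k => [|k IH].
    rewrite !expr0 mulmx1 (_ : mk2 1 0 0 1 = 1%:M) ?mul1mx //.
    by apply: mx2P; rewrite !mxE.
  rewrite exprSr -mulmxE mulmxA IH -mulmxA PN mulmxA mulmxE mk2M -!exprSr.
  by rewrite !(mulr0, mul0r, addr0, add0r).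
have scalarP k c : (P *m N ^+ k = c%:M *m P) -> N ^+ k = c%:M.
  move=> e; rewrite -[LHS](mulKmx uP) e -(scalar_mxC c P) mulmxA mulVmx // mul1mx //.
have mk2I (p q p' q' : K) : mk2 p 0 0 q *m P = mk2 p' 0 0 q' *m P -> p = p' /\ q = q'.
  move/(congr1 (fun X => X *m invmx P)); rewrite !mulmxK // => /matrixP E.
  by move: (E 0 0) (E 1 1); rewrite !mxE.
have one2 : 1%:M = mk2 1 0 0 1 :> 'M[K]_2 by apply: mx2P; rewrite !mxE.
have [an dn] : 1 = a ^+ n /\ 1 = d ^+ n.
  by apply: mk2I; rewrite -PNk Nn mulmx1 -one2 mul1mx.
have a0 : a != 0.
  by apply/eqP => e; move/eqP: an; rewrite e expr0n eqn0Ngt n_gt0 oner_eq0.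
have r_ord k : (d / a) ^+ k = 1 -> (n %| k)%N.
  move=> e; apply: (Nord k (a ^+ k)); apply: scalarP; rewrite PNk; congr (_ *m P).
  have -> : d ^+ k = a ^+ k.
    by rewrite -[RHS]mul1r -e expr_div_n divfK // expf_neq0.
  by apply: mx2P; rewrite !mxE.
have [l Nl] := realizes_eigen iu fu hN.
have h8 := form_act_homog P f8.
pose v i := scale_pt (\det P)^-1 (mxact P (u i)).
have iv : pairwise_indep v.
  move=> i j ij; rewrite bracket_scale_ptl bracket_scale_ptr bracket_mxact !mulf_neq0 ?invr_eq0 //.
  exact: iu.
have rv : has_roots (fpoly 8 (form_act P f)) v.
  split=> [|y]; first exact: size_poly.
  rewrite -(fev_bform _ h8) fev_act fu; apply: eq_bigr => i _.
  by rewrite bracket_scale_ptr -{2}(mxactVK uP y) bracket_mxact mulrA mulVf // mul1r.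
exists P, (d / a); split=> //; split=> //.
- by rewrite expr_div_n -an -dn divr1.
- exact: simple_root_low rv iv.
- exact: simple_root_high rv iv.
have eig y : bform 8 (fpoly 8 (form_act P f)) (a * y.1, d * y.2) =
             l * bform 8 (fpoly 8 (form_act P f)) y.
  rewrite -!(fev_bform _ h8) !fev_act -Nl; congr (fev f _).
  have -> : (a * y.1, d * y.2) = mxact (mk2 a 0 0 d) y.
    by rewrite mxact_mk2 !mul0r addr0 add0r.
  by rewrite -{1}(mxactVK uP y) -(mxact_mul _ P) -PN mxact_mul mxactK.
have E := eigen_support a0 eig.
have half i j : (i <= j)%N -> (d / a) ^+ i = (d / a) ^+ j -> i = j %[mod n].
  move=> ij e; apply/eqP; rewrite eq_sym eqn_mod_dvd //; apply: r_ord.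
  have da0 : (d / a) ^+ i != 0.
    rewrite expf_neq0 // mulf_neq0 ?invr_eq0 //.
    by apply/eqP => d0; move/eqP: dn; rewrite d0 expr0n eqn0Ngt n_gt0 oner_eq0.
  by apply: (mulIf da0); rewrite -exprD subnK // mul1r e.
move=> i j i8 j8 Fi Fj; have e := E i j i8 j8 Fi Fj.
by case/orP: (leq_total i j) => ij; [apply: half | symmetry; apply: half].
Qed.

End Roots.

Lemma dvd_fact8_cases n : (n %| 8`!)%N -> ~~ (n %| 2)%N ->
  [\/ (3 %| n)%N, (4 %| n)%N, (5 %| n)%N | (7 %| n)%N].
Proof.
move=> n8 n2; have [|d3] := boolP (3 %| n)%N; first by constructor 1.
have [|d5] := boolP (5 %| n)%N; first by constructor 3.
have [|d7] := boolP (7 %| n)%N; first by constructor 4.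
constructor 2; move: n8.
have -> : 8`! = (3 * (3 * (5 * (7 * 2 ^ 7))))%N by rewrite !factS fact0.
have cop p : prime p -> ~~ (p %| n)%N -> coprime n p.
  by move=> pp; rewrite coprime_sym prime_coprime.
rewrite (@Gauss_dvdr n 3) ?cop // (@Gauss_dvdr n 3) ?cop //.
rewrite (@Gauss_dvdr n 5) ?cop // (@Gauss_dvdr n 7) ?cop // => n27.
have [m _ nE] : exists2 m, (m <= 7)%N & n = (2 ^ m)%N by apply/dvdn_pfactor.
move: n2; rewrite nE; case: m {nE} => [|[|m]] // _.
by rewrite !expnS mulnA dvdn_mulr.
Qed.

(** * Quartic covariants of vanishing discriminant *)

Theorem proposition2p11 (K : closedFieldType)
    (charK : forall p : nat, p \in [pchar K] -> (7 < p)%N)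
    (f : {mpoly K[2]}) (f_sep : distinct_roots 8 f)
    (disc0 : forall C : {mpoly K[2]} -> {mpoly K[2]},
       covariant 8 4 C -> quartic_disc (C f) = 0) :
  [\/ aut_has_subgroup f ('D_12)%G,
      aut_has_subgroup f (setX_group [set: 'Z_2]%G ('D_8)%G) |
      aut_has_subgroup f [set: 'Z_14]%G].
Proof.
have [u iu fu] := distinct_roots_factor f_sep.
have [f8 f0 _] := f_sep.
have nat0 n : (0 < n <= 8)%N -> n%:R != 0 :> K.
  by move=> n8; apply: (natf_dvd_fact8 charK); apply: dvdn_fact.
have two0 := nat0 2 isT.
(* if all realized permutations square to 1, some covariant quartic has four simple roots *)
have [[M [s [hM s2]]]|invol] := classic (exists M s, realizes u M s /\ (s * s)%g <> 1%g);
  last first.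
  exfalso.
  have invol' M s : realizes u M s -> (s * s = 1)%g.
    by move=> hM; apply: NNPP => s2; apply: invol; exists M, s.
  have [|||A [B [p [p' [A0 B0 pp' hq]]]]] :=
      @involutive_semi_invariant K (fun M => exists s, realizes u M s) two0.
  - by move=> M [s []].
  - by move=> M N [s hM] [t hN]; exists (t * s)%g; apply: realizesM.
  - move=> M [s hM]; apply: (fix8_scalar iu) => i.
    by have [_ /(_ i)] := realizesM iu hM hM; rewrite (invol' _ _ hM) perm1.
  have [|C covC [hC [c c0 Cf]]] :=
    @covariant_with_value K charK u f iu f8 fu A B p p' invol'.
    by move=> M s hM; apply: hq; exists s.
  have := disc0 C covC.
  rewrite (@quartic_disc_two_powers _ _ (c * A) (c * B) p p' hC); last first.
    by move=> x; rewrite Cf; ring.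
  apply/eqP; rewrite !mulf_neq0 ?expf_neq0 //.
  by rewrite -[256%N]/(2 ^ 8)%N natrX expf_neq0.
have n8 : (#[s]%g %| 8`!)%N by rewrite -card_Sn -cardsT order_dvdG ?inE.
have n2 : ~~ (#[s]%g %| 2)%N by rewrite order_dvdn expgS expg1; apply/eqP.
have power q : (0 < q)%N -> (q %| #[s]%g)%N -> exists N t, realizes u N t /\ #[t]%g = q.
  move=> q0 qs; exists (M ^+ (#[s]%g %/ q)), (s ^+ (#[s]%g %/ q))%g.
  split; first exact: realizesX.
  rewrite orderXdiv ?divnA ?dvdn_div //.
    by rewrite mulKn ?order_gt0.
(* the nonzero coefficients at both ends have indices that differ by 6, 7 or 8, so the
   order is not 5, and the orders 3 and 4 determine these indices *)
case: (dvd_fact8_cases n8 n2) => /power [] // N [t [hN tn]].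
- constructor 1.
  have [P [r [uP [r3 r_ord lo hi supp]]]] := diagonal_normal_form f8 iu fu hN tn (nat0 3 isT).
  have [F1 F7] : (fpoly 8 (form_act P f))`_1 != 0 /\ (fpoly 8 (form_act P f))`_7 != 0.
    by case: lo hi => lo [] hi //; have /(_ isT isT) := (fun h h' => supp _ _ h h' lo hi).
  apply: (embed_D12 f8 f0 uP two0 r3) => //.
    by apply/eqP => r1; have := r_ord 1%N; rewrite r1 expr1n => /(_ erefl).
  by move=> i i8 Fi; rewrite (supp i 1%N).
- constructor 2.
  have [P [r [uP [r4 r_ord lo hi supp]]]] := diagonal_normal_form f8 iu fu hN tn (nat0 4 isT).
  have [F0 F8] : (fpoly 8 (form_act P f))`_0 != 0 /\ (fpoly 8 (form_act P f))`_8 != 0.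
    by case: lo hi => lo [] hi //; have /(_ isT isT) := (fun h h' => supp _ _ h h' lo hi).
  apply: (embed_C2xD8 f8 f0 uP two0 r4) => //.
  by move=> i i8 Fi; rewrite (supp i 0%N).
- have [P [r [uP [r5 r_ord lo hi supp]]]] := diagonal_normal_form f8 iu fu hN tn (nat0 5 isT).
  by exfalso; case: lo hi => lo [] hi; have /(_ isT isT) := (fun h h' => supp _ _ h h' lo hi).
- constructor 3.
  have [N' [hN' N7 Nord]] := realizes_order iu hN.
  rewrite tn in N7 Nord.
  have [l Nl] := realizes_eigen iu fu hN'.
  exact: (embed_C14 f8 f0 two0 hN'.1 N7 Nord Nl).
Qed.
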